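(* Let $\mathfrak R$ and $\mathfrak S$ be complete, separated two-sided linear topological rings with countable bases of neighborhoods of zero, and let $\mathfrak f\colon\mathfrak R\to\mathfrak S$ be a left proflat continuous ring map. Let $\mathfrak P$ be a left $\mathfrak R$-contramodule. Then the left $\mathfrak S$-module $\operatorname{Hom}^{\mathfrak R}(\mathfrak S,\mathfrak P)$ carries a naturally defined (functorial in $\mathfrak P$) left $\mathfrak S$-contramodule structure from which its left $\mathfrak S$-module structure arises. The functor $\mathfrak f^{\text{\textexclamdown}}\colon\mathfrak R\text{-}\mathsf{Contra}\to\mathfrak S\text{-}\mathsf{Contra}$, $\mathfrak P\longmapsto\operatorname{Hom}^{\mathfrak R}(\mathfrak S,\mathfrak P)$, is right adjoint to the functor of restriction of scalars $\mathfrak f_\sharp\colon\mathfrak S\text{-}\mathsf{Contra}\to\mathfrak R\text{-}\mathsf{Contra}$. The adjunction counit $\mathfrak f_\sharp\mathfrak f^{\text{\textexclamdown}}\to\mathrm{Id}$ is the map $\operatorname{Hom}^{\mathfrak R}(\mathfrak S,\mathfrak P)\to\operatorname{Hom}^{\mathfrak R}(\mathfrak R,\mathfrak P)\simeq\mathfrak P$ induced by the left $\mathfrak R$-contramodule morphism $\mathfrak f\colon\mathfrak R\to\mathfrak S$.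
   Context: All rings are associative and unital, and ring maps are unital ring homomorphisms. A topological ring is two-sided linear if open two-sided ideals form a base of neighborhoods of zero; it is complete and separated if the natural map to the projective limit of its quotients by all open subgroups is bijective. For a ring map $\mathfrak f\colon\mathfrak R\to\mathfrak S$ and $\mathfrak I\subset\mathfrak R$, $\mathfrak f(\mathfrak I)\mathfrak S$ is the right ideal generated by $\mathfrak f(\mathfrak I)$. The map $\mathfrak f$ is strongly right taut if those open two-sided ideals $\mathfrak I\subset\mathfrak R$ for which the closure of $\mathfrak f(\mathfrak I)\mathfrak S$ in $\mathfrak S$ is an open two-sided ideal of $\mathfrak S$ form a base of neighborhoods of zero in $\mathfrak R$. A strongly right taut continuous $\mathfrak f$ is left proflat if for every open two-sided ideal $\mathfrak I\subset\mathfrak R$ such that the closure $\mathfrak J$ of $\mathfrak f(\mathfrak I)\mathfrak S$ is an open two-sided ideal in $\mathfrak S$, the ring $\mathfrak S/\mathfrak J$ is a flat left $\mathfrak R/\mathfrak I$-module. (So left proflat maps are by definition continuous and strongly right taut.) Contramodules. For a set $X$, let $\mathfrak R[[X]]$ be the set of all infinite formal linear combinations $\sum_{x\in X}r_xx$ whose coefficient families $(r_x\in\mathfrak R)_{x\in X}$ converge to zero (for every open subgroup $\mathfrak U\subset\mathfrak R$, $r_x\in\mathfrak U$ for all but finitely many $x$). A map $g\colon X\to Y$ induces $\mathfrak R[[g]]\colon\sum_x r_xx\mapsto\sum_y\bigl(\sum_{g(x)=y}r_x\bigr)y$, where infinite sums in $\mathfrak R$ are limits of finite partial sums. The functor $\mathfrak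 R[[-]]$ is a monad on sets with unit $\epsilon_X\colon x\mapsto 1\cdot x$ and multiplication $\phi_X\colon\mathfrak R[[\mathfrak R[[X]]]]\to\mathfrak R[[X]]$ given by opening parentheses. A left $\mathfrak R$-contramodule is a module (algebra) over this monad, i.e. a set $\mathfrak P$ with a map $\pi_{\mathfrak P}\colon\mathfrak R[[\mathfrak P]]\to\mathfrak P$ satisfying $\pi_{\mathfrak P}\epsilon_{\mathfrak P}=\mathrm{id}$ and $\pi_{\mathfrak P}\circ\mathfrak R[[\pi_{\mathfrak P}]]=\pi_{\mathfrak P}\circ\phi_{\mathfrak P}$. These form an abelian category $\mathfrak R\text{-}\mathsf{Contra}$ with Hom groups denoted $\operatorname{Hom}^{\mathfrak R}(-,-)$. Restricting $\pi_{\mathfrak P}$ to finite linear combinations gives the forgetful functor to left $\mathfrak R$-modules. Restriction of scalars. A continuous $\mathfrak f$ induces maps $\mathfrak R[[X]]\to\mathfrak S[[X]]$; precomposing $\pi_{\mathfrak Q}\colon\mathfrak S[[\mathfrak Q]]\to\mathfrak Q$ with $\mathfrak R[[\mathfrak Q]]\to\mathfrak S[[\mathfrak Q]]$ defines $\mathfrak f_\sharp\colon\mathfrak S\text{-}\mathsf{Contra}\to\mathfrak R\text{-}\mathsf{Contra}$. The ring $\mathfrak S$ is a left $\mathfrak S$-contramodule (free with one generator), hence via $\mathfrak f_\sharp$ a left $\mathfrak R$-contramodule; right multiplications by elements of $\mathfrak S$ are endomorphisms of this contramodule, so $\operatorname{Hom}^{\mathfrak R}(\mathfrak S,\mathfrak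 P)$ is a left $\mathfrak S$-module via $(sh)(t)=h(ts)$. The isomorphism $\operatorname{Hom}^{\mathfrak R}(\mathfrak R,\mathfrak P)\simeq\mathfrak P$ is $h\mapsto h(1)$. *)

(* Defs.v *)
From HB Require Import structures.
From mathcomp Require Import all_boot all_algebra.
From mathcomp Require Import finmap boolp classical_sets functions cardinality.
From mathcomp Require Import fsbigop topology tvs.
Set Implicit Arguments.
Unset Strict Implicit.
Unset Printing Implicit Defensive.
Import GRing.Theory.
Local Open Scope classical_set_scope.
Local Open Scope ring_scope.
Local Open Scope quotient_scope.

Record subgroup (V : zmodType) := Subgroup {
  subgroup_set :> set V;
  subgroup0 : subgroup_set 0;
  subgroupB : forall x y, subgroup_set x -> subgroup_set y ->
                subgroup_set (x - y) }.

Section Subgroup.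
Variables (V : zmodType) (U : subgroup V).

Definition subgroup_pred : V -> bool := fun x => `[< subgroup_set U x >].

Lemma subgroup_pred_closed : zmod_closed subgroup_pred.
Proof.
split=> [|x y]; first exact/asboolP/subgroup0.
by move=> /asboolP Ux /asboolP Uy; apply/asboolP/subgroupB.
Qed.

HB.instance Definition _ := GRing.isZmodClosed.Build V subgroup_pred
  subgroup_pred_closed.

Definition subgroup_zmod : zmodClosed V := GRing.ZmodClosed.clone V subgroup_pred _.
Definition quotient_group : Type := Quotient.quot subgroup_zmod.
HB.instance Definition _ := GRing.Zmodule.copy quotient_group (Quotient.quot subgroup_zmod).
Definition quotient_proj (x : V) : quotient_group := \pi_(Quotient.quot subgroup_zmod) x.

Lemma quotient_projP x y : quotient_proj x = quotient_proj y <-> subgroup_set U (x - y).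
Proof.
rewrite /quotient_proj; split=> [/eqP|Uxy]; last apply/eqP.
  by rewrite -Quotient.idealrBE => /asboolP.
by rewrite -Quotient.idealrBE; apply/asboolP.
Qed.

Lemma quotient_projD x y :
  quotient_proj (x + y) = quotient_proj x + quotient_proj y.
Proof. exact: Quotient.pi_add. Qed.

Lemma quotient_proj_surj (q : quotient_group) : exists x, q = quotient_proj x.
Proof. by exists (repr (q : (Quotient.quot subgroup_zmod))); rewrite /quotient_proj reprK. Qed.

Lemma subgroupN x : subgroup_set U x -> subgroup_set U (- x).
Proof. by move=> Ux; rewrite -sub0r; apply/subgroupB/Ux/subgroup0. Qed.

Lemma subgroupD x y :
  subgroup_set U x -> subgroup_set U y -> subgroup_set U (x + y).
Proof. by move=> Ux Uy; rewrite -[y]opprK; apply/subgroupB/subgroupN. Qed.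

Lemma subgroup_sum (T : eqType) (s : seq T) (P : pred T) (F : T -> V) :
  (forall x, x \in s -> P x -> subgroup_set U (F x)) ->
  subgroup_set U (\sum_(x <- s | P x) F x).
Proof.
move=> UF; rewrite big_seq_cond.
by apply: big_ind => [|*|x /andP[/UF]]; [exact: subgroup0|exact: subgroupD|].
Qed.

End Subgroup.

Record two_sided_ideal (R : pzRingType) := TwoSidedIdeal {
  ideal_subgroup :> subgroup R;
  ideal_mull : forall a x,
    subgroup_set ideal_subgroup x -> subgroup_set ideal_subgroup (a * x);
  ideal_mulr : forall a x,
    subgroup_set ideal_subgroup x -> subgroup_set ideal_subgroup (x * a) }.

Section QuotientRing.
Variables (R : pzRingType) (I : two_sided_ideal R).

Definition quotient_ring : Type := quotient_group I.
HB.instance Definition _ := GRing.Zmodule.on quotient_ring.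
Definition quotient_ring_proj (x : R) : quotient_ring := quotient_proj I x.

Definition quotient_ring_mul (p q : quotient_ring) : quotient_ring :=
  quotient_ring_proj (repr (p : Quotient.quot (subgroup_zmod I)) *
                 repr (q : Quotient.quot (subgroup_zmod I))).

Lemma quotient_ring_mulE x y :
  quotient_ring_mul (quotient_ring_proj x) (quotient_ring_proj y) = quotient_ring_proj (x * y).
Proof.
apply/quotient_projP.
set x' := repr _; set y' := repr _.
have Ix : subgroup_set I (x' - x) by apply/quotient_projP; rewrite /quotient_proj reprK.
have Iy : subgroup_set I (y' - y) by apply/quotient_projP; rewrite /quotient_proj reprK.
rewrite -(subrK (x' * y) (x' * y')) -addrA -mulrBr -mulrBl.
by apply: subgroupD; [exact: ideal_mull|exact: ideal_mulr].
Qed.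

Lemma quotient_ring_proj_surj (q : quotient_ring) :
  exists x, q = quotient_ring_proj x.
Proof. exact: quotient_proj_surj. Qed.

Fact quotient_ring_mulA : associative quotient_ring_mul.
Proof.
move=> p q r.
have [x ->] := quotient_ring_proj_surj p; have [y ->] := quotient_ring_proj_surj q.
case: (quotient_ring_proj_surj r) => z ->.
by rewrite !quotient_ring_mulE mulrA.
Qed.

Fact quotient_ring_mul1l : left_id (quotient_ring_proj 1) quotient_ring_mul.
Proof.
by move=> p; have [x ->] := quotient_ring_proj_surj p; rewrite quotient_ring_mulE mul1r.
Qed.

Fact quotient_ring_mul1r : right_id (quotient_ring_proj 1) quotient_ring_mul.
Proof.
by move=> p; have [x ->] := quotient_ring_proj_surj p; rewrite quotient_ring_mulE mulr1.
Qed.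

Fact quotient_ring_mulDl : left_distributive quotient_ring_mul +%R.
Proof.
move=> p q r.
have [x ->] := quotient_ring_proj_surj p; have [y ->] := quotient_ring_proj_surj q.
case: (quotient_ring_proj_surj r) => z ->.
by rewrite -[_ + _ in LHS]quotient_projD !quotient_ring_mulE mulrDl [LHS]quotient_projD.
Qed.

Fact quotient_ring_mulDr : right_distributive quotient_ring_mul +%R.
Proof.
move=> p q r.
have [x ->] := quotient_ring_proj_surj p; have [y ->] := quotient_ring_proj_surj q.
case: (quotient_ring_proj_surj r) => z ->.
by rewrite -[_ + _ in LHS]quotient_projD !quotient_ring_mulE mulrDr [LHS]quotient_projD.
Qed.

HB.instance Definition _ := GRing.Zmodule_isPzRing.Build quotient_ring
  quotient_ring_mulA quotient_ring_mul1l quotient_ring_mul1r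
  quotient_ring_mulDl quotient_ring_mulDr.

End QuotientRing.

(* For f(I) contained in J: S/J as a left R/I-module, (r + I)(s + J) = f(r)s + J. *)
Section QuotientModule.
Variables (R S : pzRingType) (f : {rmorphism R -> S}).
Variables (I : two_sided_ideal R) (J : two_sided_ideal S).
Hypothesis fIJ : forall x, subgroup_set I x -> subgroup_set J (f x).

Definition quotient_module : Type := let _ := fIJ in quotient_ring J.
HB.instance Definition _ := GRing.PzRing.on quotient_module.

Definition quotient_module_scale (p : quotient_ring I) (m : quotient_module) :
  quotient_module :=
  quotient_ring_proj J (f (repr (p : Quotient.quot (subgroup_zmod I)))) * m.

Lemma quotient_module_scaleE x (m : quotient_module) :
  quotient_module_scale (quotient_ring_proj I x) m = quotient_ring_proj J (f x) * m.
Proof.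
congr (_ * m); apply/quotient_projP; rewrite -rmorphB; apply: fIJ.
by apply/quotient_projP; rewrite /quotient_proj reprK.
Qed.

Fact quotient_module_scaleA p q m :
  quotient_module_scale p (quotient_module_scale q m) = quotient_module_scale (p * q) m.
Proof.
have [x ->] := quotient_ring_proj_surj p; have [y ->] := quotient_ring_proj_surj q.
rewrite [_ * _]quotient_ring_mulE !quotient_module_scaleE rmorphM.
by rewrite -[quotient_ring_proj J (_ * _)]quotient_ring_mulE [LHS]mulrA.
Qed.

Fact quotient_module_scale1 : left_id 1 quotient_module_scale.
Proof. by move=> m; rewrite quotient_module_scaleE rmorph1 [LHS]mul1r. Qed.

Fact quotient_module_scaleDr : right_distributive quotient_module_scale +%R.
Proof. by move=> p m n; rewrite /quotient_module_scale mulrDr. Qed.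

Fact quotient_module_scaleDl m : {morph quotient_module_scale^~ m : p q / p + q}.
Proof.
move=> p q.
have [x ->] := quotient_ring_proj_surj p; have [y ->] := quotient_ring_proj_surj q.
rewrite -[_ + _ in LHS]quotient_projD !quotient_module_scaleE rmorphD.
by rewrite [quotient_ring_proj J (_ + _)]quotient_projD [LHS]mulrDl.
Qed.

HB.instance Definition _ := GRing.Zmodule_isLmodule.Build (quotient_ring I)
  quotient_module quotient_module_scaleA quotient_module_scale1
  quotient_module_scaleDr quotient_module_scaleDl.

End QuotientModule.

(* A right A-module is a left module over the converse ring A^c. The tensor
   product of N and M over A is the commutative monoid generated by the symbols
   (n, m), whose elements are represented by lists of pairs, modulo biadditivity
   and (n a, m) = (n, a m); it is a group since (-n, m) is opposite to (n, m). *)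
Section Tensor.
Variables (A : pzRingType) (N : lmodType A^c) (M : lmodType A).

Inductive tensor_rel : seq (N * M) -> seq (N * M) -> Prop :=
| tensor_refl s : tensor_rel s s
| tensor_sym s t : tensor_rel s t -> tensor_rel t s
| tensor_trans s t u : tensor_rel s t -> tensor_rel t u -> tensor_rel s u
| tensor_cat s s' t t' : tensor_rel s s' -> tensor_rel t t' ->
    tensor_rel (s ++ t) (s' ++ t')
| tensor_catC s t : tensor_rel (s ++ t) (t ++ s)
| tensor_addl n n' m : tensor_rel [:: (n + n', m)] [:: (n, m); (n', m)]
| tensor_addr n m m' : tensor_rel [:: (n, m + m')] [:: (n, m); (n, m')]
| tensor_zerol m : tensor_rel [:: (0, m)] [::]
| tensor_zeror n : tensor_rel [:: (n, 0)] [::]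
| tensor_balanced (a : A) n m :
    tensor_rel [:: ((a : A^c) *: n, m)] [:: (n, a *: m)].

Definition tensor_relb (s t : seq (N * M)) : bool := `[< tensor_rel s t >].

Lemma tensor_relb_equiv : equiv_class_of tensor_relb.
Proof.
split=> [s|s t|t s u]; first exact/asboolP/tensor_refl.
  by apply/asbool_equiv_eq; split; exact: tensor_sym.
by move=> /asboolP st /asboolP tu; apply/asboolP/tensor_trans/tu.
Qed.

Canonical tensor_equiv := EquivRelPack tensor_relb_equiv.
Canonical tensor_encModRel := defaultEncModRel tensor_relb.
Definition tensor : Type := {eq_quot tensor_relb}.
Definition tensor_class (s : seq (N * M)) : tensor := \pi_({eq_quot tensor_relb}) s.
Definition tensor_repr (t : tensor) : seq (N * M) :=
  repr (t : {eq_quot tensor_relb}).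

Lemma tensor_classP s t : tensor_class s = tensor_class t <-> tensor_rel s t.
Proof.
split=> [/eqP|st]; last apply/eqP; rewrite /tensor_class piE.
  by move/asboolP.
exact/asboolP.
Qed.

End Tensor.

Definition tensor_map (A : pzRingType) (N N' : lmodType A^c) (M : lmodType A)
    (g : {linear N -> N'}) (t : tensor N M) : tensor N' M :=
  tensor_class [seq (g x.1, x.2) | x <- tensor_repr t].

Lemma tensor_rel_map (A : pzRingType) (N N' : lmodType A^c) (M : lmodType A)
    (g : {linear N -> N'}) (s t : seq (N * M)) : tensor_rel s t ->
  tensor_rel [seq (g x.1, x.2) | x <- s] [seq (g x.1, x.2) | x <- t].
Proof.
elim => {s t} [s|s t _|s t u _ st _|s s' t t' _ st _|s t|n n' m|n m m'|m|n|a n m].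
- exact: tensor_refl.
- exact: tensor_sym.
- exact: tensor_trans.
- by rewrite !map_cat; exact: tensor_cat.
- by rewrite !map_cat; exact: tensor_catC.
- by rewrite /= linearD; exact: tensor_addl.
- exact: tensor_addr.
- by rewrite /= linear0; exact: tensor_zerol.
- exact: tensor_zeror.
- by rewrite /= linearZ_LR; exact: tensor_balanced.
Qed.

Lemma tensor_mapE (A : pzRingType) (N N' : lmodType A^c) (M : lmodType A)
    (g : {linear N -> N'}) (s : seq (N * M)) :
  tensor_map g (tensor_class s) = tensor_class [seq (g x.1, x.2) | x <- s].
Proof.
apply/tensor_classP/tensor_rel_map/tensor_classP.
by rewrite /tensor_class /tensor_repr reprK.
Qed.

(* M is flat: the functor - (x) M on right A-modules preserves injections. *)
Definition flat_left_module (A : pzRingType) (M : lmodType A) : Prop :=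
  forall (N N' : lmodType A^c) (g : {linear N -> N'}),
    injective g -> injective (@tensor_map A N N' M g).

HB.mixin Record isTopologicalRing R & TopologicalZmodule R & GRing.PzRing R := {
  mul_continuous : continuous (fun x : R * R => x.1 * x.2) }.

#[short(type="topologicalRingType")]
HB.structure Definition TopologicalRing :=
  {R of TopologicalZmodule R & GRing.PzRing R & isTopologicalRing R}.

Section TopologicalRing.
Variable R : topologicalRingType.

(* B is a base of neighborhoods of zero. *)
Definition zero_base (B : set_system R) : Prop :=
  (forall b, B b -> nbhs (0 : R) b) /\
  (forall V, nbhs (0 : R) V -> exists2 b, B b & b `<=` V).

Definition is_open_two_sided_ideal (A : set R) : Prop :=
  open A /\ exists J : two_sided_ideal R, A = subgroup_set J.

Definition two_sided_linear : Prop := zero_base is_open_two_sided_ideal.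

Definition countable_zero_base : Prop :=
  exists2 B : set_system R, countable B & zero_base B.

Record open_subgroup := OpenSubgroup {
  open_subgroup_subgroup :> subgroup R;
  open_subgroupP : open (open_subgroup_subgroup : set R) }.

(* The projective limit of the quotients by all open subgroups: for U contained
   in V, the component at V is the image of the component at U. *)
Record proj_limit := ProjLimit {
  proj_limit_component :> forall U : open_subgroup, quotient_group U;
  proj_limit_compat : forall U V : open_subgroup, U `<=` V -> forall x : R,
    proj_limit_component U = quotient_proj U x ->
    proj_limit_component V = quotient_proj V x }.

Lemma to_proj_limit_subproof (y : R) (U V : open_subgroup) : U `<=` V ->
  forall x, quotient_proj U y = quotient_proj U x ->
            quotient_proj V y = quotient_proj V x.
Proof. by move=> UV x /quotient_projP/UV/quotient_projP. Qed.

Definition to_proj_limit (y : R) : proj_limit :=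
  ProjLimit (@to_proj_limit_subproof y).

Definition complete_separated : Prop := bijective to_proj_limit.

Definition right_ideal (K : set R) : Prop :=
  [/\ K 0, forall x y, K x -> K y -> K (x - y) &
      forall a x, K x -> K (x * a)].

Definition right_ideal_generated (A : set R) : set R := smallest right_ideal A.

End TopologicalRing.

#[short(type="continuousRMorphism")]
HB.structure Definition ContinuousRMorphism (R S : topologicalRingType) :=
  {f of @GRing.RMorphism R S f & @Continuous R S f}.

HB.mixin Record isLinearComplete R & TopologicalRing R := {
  linear_topology : two_sided_linear R;
  complete_topology : complete_separated R }.

#[short(type="completeLinearRingType")]
HB.structure Definition CompleteLinearRing :=
  {R of TopologicalRing R & isLinearComplete R}.

(* The family r converges to zero. *)
Definition zero_family (R : topologicalRingType) (X : Type) (r : X -> R) : Prop :=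
  forall U : open_subgroup R, finite_set [set x | ~ subgroup_set U (r x)].

(* The filter of tails of the directed set of finite subsets of A. *)
Definition finite_subsets (X : Type) (A : set X) : set_system (set X) :=
  filter_from [set F | finite_set F /\ F `<=` A]
              (fun F => [set G | [/\ finite_set G, F `<=` G & G `<=` A]]).

Definition is_infsum (R : topologicalRingType) (X : Type) (A : set X)
    (r : X -> R) (s : R) : Prop :=
  (fun G : set {classic X} => \sum_(x \in G) r x) @ finite_subsets A --> s.

(* The limit of the finite partial sums over A, 0 when there is none; it exists
   for zero-convergent families in complete separated linear rings (infsumP),
   and is unique there. *)
Definition infsum (R : topologicalRingType) (X : Type) (A : set X)
    (r : X -> R) : R :=
  xget 0 [set s | is_infsum A r s].

Section Sums.
Variable R : completeLinearRingType.
Implicit Types (I : two_sided_ideal R) (U : open_subgroup R) (a b : R).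

Lemma open_subgroup_nbhs U : nbhs (0 : R) (subgroup_set U).
Proof. by apply: open_nbhs_nbhs; split; [exact: open_subgroupP|exact: subgroup0]. Qed.

Lemma nbhs_shift (a : R) (V : set R) : nbhs 0 V -> nbhs a [set x | V (x - a)].
Proof.
move=> V0; have := @sub_continuous R (a, a); rewrite /continuous_at /= subrr.
move=> /(_ V V0) [[B C] [/= Ba Ca] BC].
apply: filterS Ba => x Bx; apply: (BC (x, a)); split => //=.
exact: nbhs_singleton.
Qed.

Lemma nbhs_unshift (a : R) (V : set R) : nbhs a V -> nbhs 0 [set x | V (a + x)].
Proof.
move=> V0; have := @add_continuous R (a, 0); rewrite /continuous_at /= addr0.
move=> /(_ V V0) [[B C] [/= Ba Ca] BC].
apply: filterS Ca => x Cx; apply: (BC (a, x)); split => //=.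
exact: nbhs_singleton.
Qed.

Lemma open_subgroup_in (V : set R) : nbhs 0 V ->
  exists I, open (subgroup_set I) /\ subgroup_set I `<=` V.
Proof.
move=> /(linear_topology.2 _) [b /= [bo [J bJ]] bV]; exists J.
by rewrite -bJ.
Qed.

Lemma open_subgroup_of_nbhs (U : subgroup R) :
  nbhs (0 : R) (subgroup_set U) -> open (subgroup_set U).
Proof.
move=> U0; rewrite openE => x Ux; apply: filterS (nbhs_shift x U0) => y /= Uyx.
by rewrite -(subrK x y); apply: subgroupD.
Qed.

Lemma eq_mod_open a b :
  (forall I, open (subgroup_set I) -> subgroup_set I (a - b)) -> a = b.
Proof.
move=> ab; apply: (bij_inj complete_topology).
have E (U : open_subgroup R) : to_proj_limit a U = to_proj_limit b U.
  apply/quotient_projP; have [I [Io IU]] := open_subgroup_in (open_subgroup_nbhs U).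
  exact/IU/ab.
case: (to_proj_limit a) (to_proj_limit b) E => c cc [d dd] /= E.
have cd : c = d by exact: functional_extensionality_dep.
by rewrite cd in cc *; congr ProjLimit; exact: Prop_irrelevance.
Qed.

Lemma is_infsumP (X : Type) (A : set X) (r : X -> R) s :
  (forall I, open (subgroup_set I) ->
     exists2 t : seq {classic X}, forall x, x \in t -> A x &
     forall t' : seq {classic X}, uniq t' -> (forall x, x \in t' -> A x) ->
       {subset t <= t'} -> subgroup_set I (\sum_(x <- t') r x - s)) ->
  is_infsum A r s.
Proof.
move=> H V; rewrite /= => Vs.
have [I [Io IV]] := open_subgroup_in (nbhs_unshift Vs).
have [t tA tI] := H I Io.
exists ([set x : {classic X} | x \in t] : set X); first by split; [exact: (@finite_seq {classic X}) | exact: tA].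
move=> G /= [Gf tG GA]; rewrite fsbig_finite//=.
rewrite -(subrK s (bigop _ _ _)) addrC; apply: IV; apply: tI.
- exact: fset_uniq.
- by move=> x; rewrite in_fset_set// inE => /GA.
- by move=> x xt; rewrite in_fset_set// inE; exact: tG.
Qed.

Section Family.
Variables (X : Type) (r : X -> R).
Hypothesis r0 : zero_family r.

Let bad (U : open_subgroup R) : seq {classic X} :=
  fset_set ([set x : {classic X} | ~ subgroup_set U (r x)]).

Let badP U x : (x \in bad U) = (x \in [set x | ~ subgroup_set U (r x)]).
Proof. by rewrite in_fset_set//; exact: r0. Qed.

Let sum_restrict (A : set X) (U : subgroup R) (t t' : seq {classic X}) :
  uniq t -> uniq t' ->
  (forall x, A x -> (x : {classic X}) \in t -> x \notin t' -> subgroup_set U (r x)) ->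
  (forall x, A x -> (x : {classic X}) \in t' -> x \notin t -> subgroup_set U (r x)) ->
  subgroup_set U (\sum_(x <- t | `[< A x >]) r x - \sum_(x <- t' | `[< A x >]) r x).
Proof.
move=> ut ut' tt' t't.
rewrite (bigID (fun x => x \in t')) /= [in X in _ - X](bigID (fun x => x \in t)) /=.
have -> : \sum_(x <- t | `[< A x >] && (x \in t')) r x =
          \sum_(x <- t' | `[< A x >] && (x \in t)) r x.
  rewrite -big_filter -[RHS]big_filter; apply: perm_big; apply: uniq_perm.
  - exact: filter_uniq.
  - exact: filter_uniq.
  - by move=> x; rewrite !mem_filter -!andbA [(x \in t) && _]andbC.
rewrite opprD addrACA subrr add0r; apply: subgroupB;
  by apply: subgroup_sum => x xt /andP[/asboolP Ax]; auto.
Qed.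

Lemma infsum_exists (A : set X) : exists s, is_infsum A r s.
Proof.
have [g _ Kg] := @complete_topology R.
pose c U := quotient_proj U (\sum_(x <- bad U | `[< A x >]) r x).
have cc (U V : open_subgroup R) : subgroup_set U `<=` subgroup_set V ->
    forall x, c U = quotient_proj U x -> c V = quotient_proj V x.
  move=> UV x /quotient_projP/UV Ux; apply/quotient_projP.
  rewrite -(subrK (\sum_(x <- bad U | `[< A x >]) r x) (\sum_(x <- bad V | _) _)) -addrA.
  apply: subgroupD => //; apply: sum_restrict; rewrite ?fset_uniq//.
  - move=> y _ _; rewrite badP notin_setE /= => /contrapT/UV; exact.
  - by move=> y _ _; rewrite badP notin_setE /= => /contrapT.
exists (g (ProjLimit cc)); apply: is_infsumP => I Io.
pose U := OpenSubgroup Io.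
have := Kg (ProjLimit cc) => /(congr1 (fun z => proj_limit_component z U)) /=.
move=> /quotient_projP gU.
exists [seq x <- bad U | `[< A x >]].
  by move=> x; rewrite mem_filter => /andP[/asboolP].
move=> t' ut' t'A tt'; rewrite -opprB; apply: (@subgroupN _ U).
rewrite -(subrK (\sum_(x <- bad U | `[< A x >]) r x) (g _)) -addrA.
apply: subgroupD => //.
have -> : \sum_(x <- t') r x = \sum_(x <- t' | `[< A x >]) r x.
  by rewrite [in RHS]big_seq_cond [in LHS]big_seq; apply: eq_bigl => x;
    case xt' : (x \in t') => //=; rewrite asboolT//; exact: t'A.
apply: sum_restrict; rewrite ?fset_uniq//.
  move=> x Ax xt /negP[]; apply: tt'; rewrite mem_filter xt andbT; exact/asboolP.
by move=> y _ _; rewrite badP notin_setE /= => /contrapT.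
Qed.

Lemma infsumP (A : set X) : is_infsum A r (infsum A r).
Proof. by have [s rs] := infsum_exists A; exact: (@xgetPex _ 0 [set s | is_infsum A r s] (ex_intro _ s rs)). Qed.

(* Modulo an open subgroup, an infinite sum is a finite partial sum. *)
Lemma infsum_mod (A : set X) U (t : seq {classic X}) : uniq t ->
  (forall x, A x -> (x : {classic X}) \notin t -> subgroup_set U (r x)) ->
  subgroup_set U (infsum A r - \sum_(x <- t | `[< A x >]) r x).
Proof.
move=> ut tU.
have [F [Ff FA] FU] := @infsumP A _ (nbhs_shift _ (open_subgroup_nbhs U)).
pose G : set {classic X} := F `|` [set x | (x : {classic X}) \in t /\ A x].
have Gf : finite_set G.
  rewrite finite_setU; split => //.
  apply: (@sub_finite_set _ _ [set x : {classic X} | x \in t]); first by move=> x [].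
  exact: (@finite_seq {classic X}).
have GA : G `<=` A by move=> x [/FA|[]].
have /FU : [/\ finite_set G, F `<=` G & G `<=` A].
  by split=> //; exact: subsetUl.
rewrite /= fsbig_finite//= => GU.
rewrite -(subrK (\sum_(x <- fset_set (G : set {classic X})) r x) (infsum A r)) -addrA.
apply: subgroupD; first by rewrite -opprB; exact: subgroupN.
set s' := bigop _ _ _.
have -> : s' = \sum_(x <- fset_set (G : set {classic X}) | `[< A x >]) r x.
  rewrite [in RHS]big_seq_cond /s' [in LHS]big_seq; apply: eq_bigl => x;
    case xt' : (x \in _) => //=; rewrite asboolT//.
  by apply: GA; move: xt'; rewrite in_fset_set// => /set_mem.
apply: sum_restrict; rewrite ?fset_uniq//.
  by move=> x Ax _ xt; exact: tU.
move=> x Ax xt /negP[]; suff : (x : {classic X}) \in fset_set G by [].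
by rewrite in_fset_set//; apply: mem_set; right.
Qed.

End Family.
End Sums.

Section Infsum.
Variable R : completeLinearRingType.
Implicit Types (X Y : Type) (I : two_sided_ideal R) (U : open_subgroup R).

Definition isum X (r : X -> R) : R := infsum setT r.

Lemma zero_family_seq X (r : X -> R) I : open (subgroup_set I) -> zero_family r ->
  exists2 t : seq {classic X}, uniq t &
    forall x : X, (x : {classic X}) \notin t -> subgroup_set I (r x).
Proof.
move=> Io r0; have Ufin := r0 (OpenSubgroup Io).
exists (fset_set ([set x : {classic X} | ~ subgroup_set I (r x)])).
  exact: fset_uniq.
move=> x /negP xN; apply: contrapT => rx; apply: xN.
suff : (x : {classic X}) \in fset_set ([set x : {classic X} | ~ subgroup_set I (r x)]) by [].
by rewrite in_fset_set//; exact: mem_set.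
Qed.

Lemma zero_familyI X (r : X -> R) :
  (forall I, open (subgroup_set I) -> exists t : seq {classic X},
    forall x : X, (x : {classic X}) \notin t -> subgroup_set I (r x)) ->
  zero_family r.
Proof.
move=> H U; have [I [Io IU]] := open_subgroup_in (open_subgroup_nbhs U).
have [t tI] := H I Io.
apply: (@sub_finite_set _ _ [set x : {classic X} | x \in t]).
  by move=> x /= rx; apply: contrapT => /negP /tI /IU.
exact: (@finite_seq {classic X}).
Qed.

Lemma infsum_in X (A : set X) (r : X -> R) I : open (subgroup_set I) ->
  zero_family r -> (forall x, A x -> subgroup_set I (r x)) ->
  subgroup_set I (infsum A r).
Proof.
move=> Io r0 rI.
have := @infsum_mod R X r r0 A (OpenSubgroup Io) [::] isT.
by rewrite big_nil subr0; apply=> x Ax _; exact: rI.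
Qed.

Lemma isum_in X (r : X -> R) I : open (subgroup_set I) ->
  zero_family r -> (forall x, subgroup_set I (r x)) -> subgroup_set I (isum r).
Proof. by move=> Io r0 rI; apply: infsum_in => // x _. Qed.

Lemma isum_mod X (r : X -> R) I (t : seq {classic X}) : open (subgroup_set I) ->
  zero_family r -> uniq t ->
  (forall x : X, (x : {classic X}) \notin t -> subgroup_set I (r x)) ->
  subgroup_set I (isum r - \sum_(x <- t) r x).
Proof.
move=> Io r0 ut tI.
have := @infsum_mod R X r r0 setT (OpenSubgroup Io) t ut (fun x _ => tI x).
by rewrite (eq_bigl xpredT)// => x; exact: asboolT.
Qed.

Lemma sub_zero_family X (r r' : X -> R) :
  (forall I x, subgroup_set I (r x) -> subgroup_set I (r' x)) ->
  zero_family r -> zero_family r'.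
Proof.
move=> H r0; apply: zero_familyI => I Io; have [t _ tI] := zero_family_seq Io r0.
by exists t => x /tI; exact: H.
Qed.

Lemma zero_familyD X (r r' : X -> R) : zero_family r -> zero_family r' ->
  zero_family (fun x => r x + r' x).
Proof.
move=> r0 r0'; apply: zero_familyI => I Io.
have [t _ tI] := zero_family_seq Io r0; have [t' _ tI'] := zero_family_seq Io r0'.
exists (t ++ t') => x; rewrite mem_cat negb_or => /andP[/tI ? /tI' ?].
exact: subgroupD.
Qed.

Lemma infsum_mask X (A : set X) (r : X -> R) : zero_family r ->
  infsum A r = isum (fun x => `[< A x >]%:R * r x).
Proof.
move=> r0; apply: eq_mod_open => I Io; have [t ut tI] := zero_family_seq Io r0.
have m0 : zero_family (fun x => `[< A x >]%:R * r x).
  by apply: (sub_zero_family _ r0) => J x; exact: ideal_mull.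
have := @infsum_mod R X r r0 A (OpenSubgroup Io) t ut (fun x _ => tI x).
have /(isum_mod Io m0 ut) : forall x : X, (x : {classic X}) \notin t ->
   subgroup_set I (`[< A x >]%:R * r x).
  by move=> x /tI; exact: ideal_mull.
rewrite (big_mkcond (fun x => `[< A x >])) /=.
have -> : \sum_(x <- t) (if `[< A x >] then r x else 0) =
          \sum_(x <- t) `[< A x >]%:R * r x.
  by apply: eq_bigr => x _; case: ifP; rewrite ?mul1r ?mul0r.
move=> h1 h2; rewrite -(subrK (\sum_(x <- t) `[< A x >]%:R * r x) (infsum A r)) -addrA.
by apply: subgroupD => //; rewrite -opprB; exact: subgroupN.
Qed.

Lemma isumD X (r r' : X -> R) : zero_family r -> zero_family r' ->
  isum (fun x => r x + r' x) = isum r + isum r'.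
Proof.
move=> r0 r0'; apply: eq_mod_open => I Io.
have [t0 _ tI] := zero_family_seq Io r0; have [t0' _ tI'] := zero_family_seq Io r0'.
pose t := undup (t0 ++ t0').
have ut : uniq t by exact: undup_uniq.
have Ir (x : X) : (x : {classic X}) \notin t -> subgroup_set I (r x).
  by rewrite mem_undup mem_cat negb_or => /andP[/tI].
have Ir' (x : X) : (x : {classic X}) \notin t -> subgroup_set I (r' x).
  by rewrite mem_undup mem_cat negb_or => /andP[_ /tI'].
have h := isum_mod Io r0 ut Ir; have h' := isum_mod Io r0' ut Ir'.
have /(isum_mod Io (zero_familyD r0 r0') ut) H : forall x : X,
    (x : {classic X}) \notin t -> subgroup_set I (r x + r' x).
  by move=> x xt; apply: subgroupD; auto.
rewrite -(subrK (\sum_(x <- t) (r x + r' x)) (isum (fun x => r x + r' x))) -addrA.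
apply: subgroupD => //; rewrite big_split /= opprD addrACA.
by apply: subgroupD; rewrite -opprB; exact: subgroupN.
Qed.

Lemma zero_familyMl X (r : X -> R) a : zero_family r -> zero_family (fun x => a * r x).
Proof. by apply: sub_zero_family => I x; exact: ideal_mull. Qed.

Lemma zero_familyMr X (r s : X -> R) :
  zero_family r -> zero_family (fun x => r x * s x).
Proof. by apply: sub_zero_family => I x; exact: ideal_mulr. Qed.

Lemma isumMl X (r : X -> R) a : zero_family r ->
  isum (fun x => a * r x) = a * isum r.
Proof.
move=> r0; apply: eq_mod_open => I Io; have [t ut tI] := zero_family_seq Io r0.
have h := isum_mod Io r0 ut tI.
have /(isum_mod Io (zero_familyMl a r0) ut) H : forall x : X,
    (x : {classic X}) \notin t -> subgroup_set I (a * r x).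
  by move=> x /tI; exact: ideal_mull.
rewrite -(subrK (\sum_(x <- t) (a * r x)) (isum (fun x => a * r x))) -addrA.
apply: subgroupD => //; rewrite -mulr_sumr -mulrBr; apply: ideal_mull.
by rewrite -opprB; exact: subgroupN.
Qed.

Lemma isumMr X (r : X -> R) a : zero_family r ->
  isum (fun x => r x * a) = isum r * a.
Proof.
move=> r0; apply: eq_mod_open => I Io; have [t ut tI] := zero_family_seq Io r0.
have h := isum_mod Io r0 ut tI.
have /(isum_mod Io (zero_familyMr (fun=> a) r0) ut) H : forall x : X,
    (x : {classic X}) \notin t -> subgroup_set I (r x * a).
  by move=> x /tI; exact: ideal_mulr.
rewrite -(subrK (\sum_(x <- t) (r x * a)) (isum (fun x => r x * a))) -addrA.
apply: subgroupD => //; rewrite -mulr_suml -mulrBl; apply: ideal_mulr.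
by rewrite -opprB; exact: subgroupN.
Qed.

Lemma isum_single X (r : X -> R) (a : X) : (forall x, x <> a -> r x = 0) ->
  isum r = r a.
Proof.
move=> ra; apply: eq_mod_open => I Io.
have Ir x : (x : {classic X}) \notin [:: a : {classic X}] -> subgroup_set I (r x).
  rewrite inE => /eqP xa; rewrite ra//; exact: subgroup0.
have r0 : zero_family r.
  apply: zero_familyI => J Jo; exists [:: a : {classic X}] => x.
  rewrite inE => /eqP xa; rewrite ra//; exact: subgroup0.
by have := isum_mod Io r0 (isT : uniq [:: a : {classic X}]) Ir; rewrite big_seq1.
Qed.

Definition zero_family2 X Y (r : X -> Y -> R) : Prop :=
  forall I, open (subgroup_set I) ->
  exists (t : seq {classic X}) (u : seq {classic Y}), forall (x : X) (y : Y),
    (x : {classic X}) \notin t \/ (y : {classic Y}) \notin u -> subgroup_set I (r x y).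

Lemma zero_family2C X Y (r : X -> Y -> R) :
  zero_family2 r -> zero_family2 (fun y x => r x y).
Proof.
move=> r0 I Io; have [t [u H]] := r0 I Io.
by exists u, t => x y xy; apply: H; case: xy; [right|left].
Qed.

Lemma zero_family2_in X Y (r : X -> Y -> R) : zero_family2 r ->
  forall x, zero_family (r x).
Proof.
move=> r0 x; apply: zero_familyI => I /r0 [t [u H]].
by exists u => y yu; apply: H; right.
Qed.

Lemma zero_family2_out X Y (r : X -> Y -> R) : zero_family2 r ->
  zero_family (fun x => isum (r x)).
Proof.
move=> r0; apply: zero_familyI => I Io; have [t [u H]] := r0 I Io.
exists t => x xt; apply: isum_in => //; first exact: zero_family2_in.
by move=> y; apply: H; left.
Qed.

Lemma isum_double X Y (r : X -> Y -> R) I : zero_family2 r ->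
  open (subgroup_set I) -> forall t u, uniq t -> uniq u ->
  (forall x y, (x : {classic X}) \notin t \/ (y : {classic Y}) \notin u ->
    subgroup_set I (r x y)) ->
  subgroup_set I (isum (fun x => isum (r x)) - \sum_(x <- t) \sum_(y <- u) r x y).
Proof.
move=> r0 Io t u ut uu H.
have /(isum_mod Io (zero_family2_out r0) ut) h : forall x : X,
    (x : {classic X}) \notin t -> subgroup_set I (isum (r x)).
  move=> x xt; apply: isum_in => //; first exact: zero_family2_in.
  by move=> y; apply: H; left.
rewrite -(subrK (\sum_(x <- t) isum (r x)) (isum _)) -addrA; apply: subgroupD => //.
rewrite -sumrB; apply: subgroup_sum => x _ _; apply: isum_mod => //.
  exact: zero_family2_in.
by move=> y yu; apply: H; right.
Qed.

Lemma isum_exchange X Y (r : X -> Y -> R) : zero_family2 r ->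
  isum (fun x => isum (r x)) = isum (fun y => isum (fun x => r x y)).
Proof.
move=> r0; apply: eq_mod_open => I Io; have [t [u H]] := r0 I Io.
have {}H x y : (x : {classic X}) \notin undup t \/ (y : {classic Y}) \notin undup u ->
    subgroup_set I (r x y) by rewrite !mem_undup; exact: H.
have h1 := isum_double r0 Io (undup_uniq t) (undup_uniq u) H.
have h2 : subgroup_set I (isum (fun y => isum (fun x => r x y)) -
    \sum_(y <- undup u) \sum_(x <- undup t) r x y).
  apply: (isum_double (zero_family2C r0)) => //; try exact: undup_uniq.
  by move=> x y xy; apply: H; case: xy; [right|left].
rewrite exchange_big /= in h2.
rewrite -(subrK (\sum_(x <- undup t) \sum_(y <- undup u) r x y) (isum _)) -addrA.
by apply: subgroupD => //; rewrite -opprB; exact: subgroupN.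
Qed.

End Infsum.

Lemma zero_family_morph (R S : topologicalRingType) (f : continuousRMorphism R S)
  X (r : X -> R) : zero_family r -> zero_family (fun x => f (r x)).
Proof.
move=> r0 V.
have fB x y : subgroup_set V (f x) -> subgroup_set V (f y) -> subgroup_set V (f (x - y)).
  by rewrite rmorphB; exact: subgroupB.
have f0 : subgroup_set V (f 0) by rewrite rmorph0; exact: subgroup0.
have Uo : open (subgroup_set (Subgroup f0 fB)).
  have fc : continuous f by exact: cts_fun.
  exact: (open_comp (fun x _ => fc x) (open_subgroupP V)).
exact: (r0 (OpenSubgroup Uo)).
Qed.

Lemma isum_morph (R S : completeLinearRingType) (f : continuousRMorphism R S)
  X (r : X -> R) : zero_family r -> f (isum r) = isum (fun x => f (r x)).
Proof.
move=> r0; apply: eq_mod_open => J Jo.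
have fB x y : subgroup_set J (f x) -> subgroup_set J (f y) -> subgroup_set J (f (x - y)).
  by rewrite rmorphB; exact: subgroupB.
have f0 : subgroup_set J (f 0) by rewrite rmorph0; exact: subgroup0.
have Uo : open (subgroup_set (Subgroup f0 fB)).
  have fc : continuous f by exact: cts_fun.
  exact: (open_comp (fun x _ => fc x) Jo).
have [I [Io IU]] := open_subgroup_in (open_subgroup_nbhs (OpenSubgroup Uo)).
have [t ut tI] := zero_family_seq Io r0.
have /IU /= h := isum_mod Io r0 ut tI.
have /(isum_mod Jo (zero_family_morph f r0) ut) h' : forall x : X,
    (x : {classic X}) \notin t -> subgroup_set J (f (r x)).
  by move=> x /tI/IU.
rewrite rmorphB rmorph_sum in h.
rewrite -(subrK (\sum_(x <- t) f (r x)) (f _)) -addrA; apply: subgroupD => //.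
by rewrite -opprB; exact: subgroupN.
Qed.

(* R[[X]]: infinite formal linear combinations of elements of X with
   zero-convergent coefficients. *)
Record fcomb (R : topologicalRingType) (X : Type) := FComb {
  fcoef :> X -> R;
  fcoefP : zero_family fcoef }.

Section FComb.
Variable R : completeLinearRingType.
Implicit Types X Y Z : Type.

Lemma fcomb_eq X (r s : fcomb R X) : r =1 s -> r = s.
Proof.
case: r s => r r0 [s s0] /= /funext rs.
by rewrite rs in r0 *; congr FComb; exact: Prop_irrelevance.
Qed.

Fact fcomb_map_subproof X Y (g : X -> Y) (r : fcomb R X) :
  zero_family (fun y => infsum (g @^-1` [set y]) r).
Proof.
apply: zero_familyI => I Io; have [t _ tI] := zero_family_seq Io (fcoefP r).
exists [seq (g x : {classic Y}) | x : {classic X} <- t] => y yt.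
apply: infsum_in => //; first exact: fcoefP.
move=> x /= gx; apply: tI; apply: contra yt => xt.
by apply/mapP; exists x.
Qed.

Definition fcomb_map X Y (g : X -> Y) (r : fcomb R X) : fcomb R Y :=
  FComb (fcomb_map_subproof g r).

Fact fcomb_unit_subproof X (x : X) :
  zero_family (fun x' => if `[< x = x' >] then 1 else 0 : R).
Proof.
apply: zero_familyI => I Io; exists [:: x : {classic X}] => x'.
rewrite inE => /eqP xx'; case: asboolP => [e|_]; last exact: subgroup0.
by case: xx'.
Qed.

Definition fcomb_unit X (x : X) : fcomb R X := FComb (fcomb_unit_subproof x).
Arguments fcomb_unit {X} x.

Lemma zero_family2_bind X Y (r : fcomb R X) (k : X -> fcomb R Y) :
  zero_family2 (fun x y => r x * k x y).
Proof.
move=> I Io; have [t _ tI] := zero_family_seq Io (fcoefP r).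
have kI x : exists u : seq {classic Y}, forall y,
    (y : {classic Y}) \notin u -> subgroup_set I (k x y).
  by have [u _ uI] := zero_family_seq Io (fcoefP (k x)); exists u.
have [u uI] := choice kI.
exists t, (flatten [seq u x | x : {classic X} <- t]) => x y xy.
have [xt|/tI] := boolP ((x : {classic X}) \in t); last exact: ideal_mulr.
case: xy => [/negP//|yu]; apply/ideal_mull/uI; apply: contra yu => yu.
by apply/flattenP; exists (u x) => //; apply/mapP; exists (x : {classic X}).
Qed.

Fact fcomb_bind_subproof X Y (k : X -> fcomb R Y) (r : fcomb R X) :
  zero_family (fun y => infsum setT (fun x => r x * k x y)).
Proof. exact: (zero_family2_out (zero_family2C (zero_family2_bind r k))). Qed.

Definition fcomb_bind X Y (k : X -> fcomb R Y) (r : fcomb R X) : fcomb R Y :=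
  FComb (fcomb_bind_subproof k r).

(* Opening parentheses: the coefficient of x in \sum_t r_t t is \sum_t r_t t_x. *)
Definition fcomb_join X (r : fcomb R (fcomb R X)) : fcomb R X :=
  FComb (fcomb_bind_subproof id r).

HB.instance Definition _ X := gen_eqMixin (fcomb R X).
HB.instance Definition _ X := gen_choiceMixin (fcomb R X).

Fact fcomb_zero_subproof X : zero_family (fun _ : X => 0 : R).
Proof. by apply: zero_familyI => I _; exists [::] => x _; exact: subgroup0. Qed.
Definition fcomb_zero X : fcomb R X := FComb (@fcomb_zero_subproof X).
Definition fcomb_add X (r s : fcomb R X) : fcomb R X :=
  FComb (zero_familyD (fcoefP r) (fcoefP s)).
Definition fcomb_scale X a (r : fcomb R X) : fcomb R X :=
  FComb (zero_familyMl a (fcoefP r)).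
Definition fcomb_opp X (r : fcomb R X) : fcomb R X := fcomb_scale (-1) r.

Fact fcomb_addA X : associative (@fcomb_add X).
Proof. by move=> r s t; apply: fcomb_eq => x /=; rewrite addrA. Qed.
Fact fcomb_addC X : commutative (@fcomb_add X).
Proof. by move=> r s; apply: fcomb_eq => x /=; rewrite addrC. Qed.
Fact fcomb_add0 X : left_id (fcomb_zero X) (@fcomb_add X).
Proof. by move=> r; apply: fcomb_eq => x /=; rewrite add0r. Qed.
Fact fcomb_addN X : left_inverse (fcomb_zero X) (@fcomb_opp X) (@fcomb_add X).
Proof. by move=> r; apply: fcomb_eq => x /=; rewrite mulN1r addNr. Qed.
HB.instance Definition _ X := GRing.isZmodule.Build (fcomb R X)
  (@fcomb_addA X) (@fcomb_addC X) (@fcomb_add0 X) (@fcomb_addN X).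

Fact fcomb_scaleA X a b (r : fcomb R X) :
  fcomb_scale a (fcomb_scale b r) = fcomb_scale (a * b) r.
Proof. by apply: fcomb_eq => x /=; rewrite mulrA. Qed.
Fact fcomb_scale1 X : left_id 1 (@fcomb_scale X).
Proof. by move=> r; apply: fcomb_eq => x /=; rewrite mul1r. Qed.
Fact fcomb_scaleDr X : right_distributive (@fcomb_scale X) +%R.
Proof. by move=> a r s; apply: fcomb_eq => x /=; rewrite mulrDr. Qed.
Fact fcomb_scaleDl X (r : fcomb R X) : {morph (@fcomb_scale X)^~ r : a b / a + b}.
Proof. by move=> a b; apply: fcomb_eq => x /=; rewrite mulrDl. Qed.
HB.instance Definition _ X := GRing.Zmodule_isLmodule.Build R (fcomb R X)
  (@fcomb_scaleA X) (@fcomb_scale1 X) (@fcomb_scaleDr X) (@fcomb_scaleDl X).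

Lemma fcomb_mapE X Y (g : X -> Y) (r : fcomb R X) :
  fcomb_map g r = fcomb_bind (fcomb_unit \o g) r.
Proof.
apply: fcomb_eq => y /=; rewrite infsum_mask; last exact: fcoefP.
rewrite -/(isum (fun x => r x * _)); congr isum; apply/funext => x /=.
by case: asboolP => _; rewrite ?mul1r ?mulr1 ?mul0r ?mulr0.
Qed.

Lemma fcomb_joinE X (r : fcomb R (fcomb R X)) : fcomb_join r = fcomb_bind id r.
Proof. by []. Qed.

Lemma fcomb_bind_unit X Y (k : X -> fcomb R Y) x :
  fcomb_bind k (fcomb_unit x) = k x.
Proof.
apply: fcomb_eq => y /=; rewrite -/(isum _) (@isum_single _ _ _ x).
  by rewrite asboolT// mul1r.
by move=> x' xx'; rewrite asboolF ?mul0r// => /esym.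
Qed.

Lemma fcomb_bind_bind X Y Z (k : Y -> fcomb R Z) (l : X -> fcomb R Y) (r : fcomb R X) :
  fcomb_bind k (fcomb_bind l r) = fcomb_bind (fun x => fcomb_bind k (l x)) r.
Proof.
apply: fcomb_eq => z /=; rewrite -!/(isum _).
have l0 x := zero_familyMr (fun y => k y z) (fcoefP (l x)).
have -> : (fun x => r x * infsum setT (fun y => l x y * k y z)) =
          (fun x => isum (fun y => r x * (l x y * k y z))).
  by apply/funext => x; rewrite isumMl.
rewrite isum_exchange.
  congr isum; apply/funext => y; rewrite -/(isum _) -isumMr.
    by congr isum; apply/funext => x; rewrite mulrA.
  exact: zero_family2_in (zero_family2C (zero_family2_bind r l)) y.
move=> I Io; have [t [u H]] := zero_family2_bind r l Io.
by exists t, u => x y /H; rewrite mulrA; exact: ideal_mulr.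
Qed.

Lemma fcomb_bindD X Y (k : X -> fcomb R Y) (r s : fcomb R X) :
  fcomb_bind k (r + s) = fcomb_bind k r + fcomb_bind k s.
Proof.
apply: fcomb_eq => y /=; rewrite -!/(isum _) -isumD.
- by congr isum; apply/funext => x; rewrite mulrDl.
- exact: zero_familyMr (fcoefP r).
- exact: zero_familyMr (fcoefP s).
Qed.

Lemma fcomb_bindZ X Y (k : X -> fcomb R Y) a (r : fcomb R X) :
  fcomb_bind k (a *: r) = a *: fcomb_bind k r.
Proof.
apply: fcomb_eq => y /=; rewrite -!/(isum _) -isumMl.
- by congr isum; apply/funext => x; rewrite mulrA.
- exact: zero_familyMr (fcoefP r).
Qed.

Lemma fcomb_bind_add X Y (k l : X -> fcomb R Y) (r : fcomb R X) :
  fcomb_bind (fun x => k x + l x) r = fcomb_bind k r + fcomb_bind l r.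
Proof.
apply: fcomb_eq => y /=; rewrite -!/(isum _) -isumD.
- by congr isum; apply/funext => x; rewrite mulrDr.
- exact: zero_familyMr (fcoefP r).
- exact: zero_familyMr (fcoefP r).
Qed.

Lemma fcomb_bind_zero X Y (r : fcomb R X) : fcomb_bind (fun=> 0 : fcomb R Y) r = 0.
Proof.
by apply: (addrI (fcomb_bind (fun=> 0) r)); rewrite -fcomb_bind_add !addr0.
Qed.

Lemma fcomb_bind_opp X Y (k : X -> fcomb R Y) (r : fcomb R X) :
  fcomb_bind (fun x => - k x) r = - fcomb_bind k r.
Proof.
apply: (addrI (fcomb_bind k r)); rewrite -(fcomb_bind_add k (fun x => - k x)) subrr.
have -> : (fun x => k x - k x) = (fun=> 0) by apply/funext => x; exact: subrr.
exact: fcomb_bind_zero.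
Qed.

Lemma fcomb_map_unit X Y (g : X -> Y) x :
  fcomb_map g (fcomb_unit x) = fcomb_unit (g x).
Proof. by rewrite fcomb_mapE fcomb_bind_unit. Qed.

Lemma fcomb_join_unit X (r : fcomb R X) : fcomb_join (fcomb_unit r) = r.
Proof. by rewrite fcomb_joinE fcomb_bind_unit. Qed.

Lemma fcomb_map_bind X Y Z (g : Y -> Z) (k : X -> fcomb R Y) (r : fcomb R X) :
  fcomb_map g (fcomb_bind k r) = fcomb_bind (fun x => fcomb_map g (k x)) r.
Proof.
rewrite fcomb_mapE fcomb_bind_bind; congr (fcomb_bind _ r).
by apply/funext => x; rewrite fcomb_mapE.
Qed.

Lemma fcomb_bind_map X Y Z (g : X -> Y) (k : Y -> fcomb R Z) (r : fcomb R X) :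
  fcomb_bind k (fcomb_map g r) = fcomb_bind (k \o g) r.
Proof.
rewrite fcomb_mapE fcomb_bind_bind; congr (fcomb_bind _ r).
by apply/funext => x /=; rewrite fcomb_bind_unit.
Qed.

Lemma fcomb_map_comp X Y Z (g : X -> Y) (h : Y -> Z) (r : fcomb R X) :
  fcomb_map h (fcomb_map g r) = fcomb_map (h \o g) r.
Proof. by rewrite [LHS]fcomb_mapE fcomb_bind_map [RHS]fcomb_mapE. Qed.

Lemma fcomb_bind_unitr X (r : fcomb R X) : fcomb_bind fcomb_unit r = r.
Proof.
apply: fcomb_eq => x /=; rewrite -/(isum _) (@isum_single _ _ _ x).
  by rewrite asboolT// mulr1.
by move=> x' xx'; rewrite asboolF ?mulr0// => /esym.
Qed.

Lemma fcomb_map_id X (r : fcomb R X) : fcomb_map id r = r.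
Proof. by rewrite fcomb_mapE fcomb_bind_unitr. Qed.

End FComb.
Arguments fcomb_unit {R X} x.

Record contra_structure (R : completeLinearRingType) (P : Type) := ContraStructure {
  contra_act :> fcomb R P -> P;
  contra_act_unit : forall p, contra_act (fcomb_unit p) = p;
  contra_act_assoc : forall r : fcomb R (fcomb R P),
    contra_act (fcomb_map contra_act r) = contra_act (fcomb_join r) }.

Record contramodule (R : completeLinearRingType) := Contramodule {
  contra_carrier :> Type;
  contra_struct : contra_structure R contra_carrier }.

Definition cact (R : completeLinearRingType) (P : contramodule R) : fcomb R P -> P :=
  contra_struct P.

Definition is_contra_hom (R : completeLinearRingType) (P Q : contramodule R)
    (h : P -> Q) : Prop :=
  forall r : fcomb R P, h (cact r) = cact (fcomb_map h r).

Record contra_hom (R : completeLinearRingType) (P Q : contramodule R) := ContraHom {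
  contra_hom_fun :> P -> Q;
  contra_homP : is_contra_hom contra_hom_fun }.

Section Contramodule.
Variable R : completeLinearRingType.
Implicit Types P Q M : contramodule R.

Lemma contra_hom_eq P Q (g h : contra_hom P Q) : g =1 h -> g = h.
Proof.
case: g h => g gP [h hP] /= /funext gh.
by rewrite gh in gP *; congr ContraHom; exact: Prop_irrelevance.
Qed.

Section Module.
Variable P : contramodule R.
Implicit Types (p q : P) (x y : fcomb R P).

Lemma cact_unit p : cact (fcomb_unit p) = p.
Proof. exact: contra_act_unit. Qed.

Lemma cact_bind X (k : X -> fcomb R P) (r : fcomb R X) :
  cact (fcomb_bind k r) = cact (fcomb_map (fun z => cact (k z)) r).
Proof.
have := contra_act_assoc (contra_struct P) (fcomb_map k r).
by rewrite fcomb_map_comp fcomb_joinE fcomb_bind_map => /esym.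
Qed.

(* The underlying R-module of P: restriction of the structure map to finite
   linear combinations. *)
Definition contra_zero : P := cact (0 : fcomb R P).
Definition contra_opp p : P := cact (- fcomb_unit p).
Definition contra_add p q : P := cact (fcomb_unit p + fcomb_unit q).
Definition contra_scale a p : P := cact (a *: fcomb_unit p).

Lemma contra_addE x y : contra_add (cact x) (cact y) = cact (x + y).
Proof.
have := cact_bind (@id (fcomb R P)) (fcomb_unit x + fcomb_unit y).
by rewrite fcomb_bindD !fcomb_bind_unit fcomb_mapE fcomb_bindD !fcomb_bind_unit.
Qed.

Lemma contra_scaleE a x : contra_scale a (cact x) = cact (a *: x).
Proof.
have := cact_bind (@id (fcomb R P)) (a *: fcomb_unit x).
by rewrite fcomb_bindZ !fcomb_bind_unit fcomb_mapE fcomb_bindZ !fcomb_bind_unit.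
Qed.

Lemma contra_oppE x : contra_opp (cact x) = cact (- x).
Proof.
transitivity (contra_scale (-1) (cact x)); first by rewrite /contra_scale scaleN1r.
by rewrite contra_scaleE scaleN1r.
Qed.

HB.instance Definition _ := gen_eqMixin (contra_carrier P).
HB.instance Definition _ := gen_choiceMixin (contra_carrier P).

Fact contra_addA : associative contra_add.
Proof.
move=> p q s; rewrite -(cact_unit p) -(cact_unit q) -(cact_unit s).
by rewrite !contra_addE addrA.
Qed.
Fact contra_addC : commutative contra_add.
Proof. by move=> p q; rewrite /contra_add addrC. Qed.
Fact contra_add0 : left_id contra_zero contra_add.
Proof. by move=> p; rewrite -(cact_unit p) contra_addE add0r. Qed.
Fact contra_addN : left_inverse contra_zero contra_opp contra_add.
Proof. by move=> p; rewrite -(cact_unit p) contra_oppE contra_addE addNr. Qed.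
HB.instance Definition _ := GRing.isZmodule.Build (contra_carrier P)
  contra_addA contra_addC contra_add0 contra_addN.

Fact contra_scaleA a b p : contra_scale a (contra_scale b p) = contra_scale (a * b) p.
Proof. by rewrite -(cact_unit p) !contra_scaleE scalerA. Qed.
Fact contra_scale1 : left_id 1 contra_scale.
Proof. by move=> p; rewrite -(cact_unit p) contra_scaleE scale1r. Qed.
Fact contra_scaleDr : right_distributive contra_scale +%R.
Proof.
move=> a p q; rewrite -(cact_unit p) -(cact_unit q).
by rewrite [_ + _ in LHS]contra_addE !contra_scaleE scalerDr [RHS]contra_addE.
Qed.
Fact contra_scaleDl p : {morph contra_scale^~ p : a b / a + b}.
Proof.
move=> a b; rewrite -(cact_unit p) !contra_scaleE scalerDl.
by rewrite [RHS]contra_addE.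
Qed.
HB.instance Definition _ := GRing.Zmodule_isLmodule.Build R (contra_carrier P)
  contra_scaleA contra_scale1 contra_scaleDr contra_scaleDl.

Lemma cactD x y : cact (x + y) = cact x + cact y.
Proof. by rewrite [RHS]contra_addE. Qed.

Lemma cactZ a x : cact (a *: x) = a *: cact x.
Proof. by rewrite [RHS]contra_scaleE. Qed.

End Module.

Lemma contra_homD P Q (h : contra_hom P Q) (p q : P) : h (p + q) = h p + h q.
Proof.
rewrite [LHS](contra_homP h) fcomb_mapE fcomb_bindD !fcomb_bind_unit /=.
by [].
Qed.

Fact contra_hom_id_subproof P : is_contra_hom (@id P).
Proof. by move=> r; rewrite fcomb_map_id. Qed.
Definition contra_hom_id P : contra_hom P P := ContraHom (@contra_hom_id_subproof P).

Fact contra_hom_comp_subproof P Q M (g : contra_hom Q M) (h : contra_hom P Q) :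
  is_contra_hom (g \o h).
Proof. by move=> r /=; rewrite !contra_homP fcomb_map_comp. Qed.
Definition contra_hom_comp P Q M (g : contra_hom Q M) (h : contra_hom P Q) :
  contra_hom P M := ContraHom (contra_hom_comp_subproof g h).

Section HomGroup.
Variables P Q : contramodule R.
Implicit Types g h : contra_hom P Q.

HB.instance Definition _ := gen_eqMixin (contra_hom P Q).
HB.instance Definition _ := gen_choiceMixin (contra_hom P Q).

Fact contra_hom_zero_subproof : is_contra_hom (fun _ : P => 0 : Q).
Proof.
move=> r; have := cact_bind (fun _ : P => 0 : fcomb R Q) r.
by rewrite fcomb_bind_zero.
Qed.
Definition contra_hom_zero : contra_hom P Q := ContraHom contra_hom_zero_subproof.

Fact contra_hom_add_subproof g h : is_contra_hom (fun p => g p + h p).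
Proof.
move=> r; pose k p := fcomb_unit (R := R) (g p) + fcomb_unit (h p).
transitivity (cact (fcomb_bind k r)); last exact: cact_bind.
by rewrite fcomb_bind_add cactD !contra_homP !fcomb_mapE.
Qed.
Definition contra_hom_add g h : contra_hom P Q :=
  ContraHom (contra_hom_add_subproof g h).

Fact contra_hom_opp_subproof h : is_contra_hom (fun p => - h p).
Proof.
move=> r; pose k p := - fcomb_unit (R := R) (h p).
transitivity (cact (fcomb_bind k r)); last exact: cact_bind.
by rewrite fcomb_bind_opp -scaleN1r cactZ scaleN1r contra_homP fcomb_mapE.
Qed.
Definition contra_hom_opp h : contra_hom P Q := ContraHom (contra_hom_opp_subproof h).

Fact contra_hom_addA : associative contra_hom_add.
Proof. by move=> g h k; apply: contra_hom_eq => p /=; rewrite addrA. Qed.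
Fact contra_hom_addC : commutative contra_hom_add.
Proof. by move=> g h; apply: contra_hom_eq => p /=; rewrite addrC. Qed.
Fact contra_hom_add0 : left_id contra_hom_zero contra_hom_add.
Proof. by move=> g; apply: contra_hom_eq => p /=; rewrite add0r. Qed.
Fact contra_hom_addN : left_inverse contra_hom_zero contra_hom_opp contra_hom_add.
Proof. by move=> g; apply: contra_hom_eq => p /=; rewrite addNr. Qed.
HB.instance Definition _ := GRing.isZmodule.Build (contra_hom P Q)
  contra_hom_addA contra_hom_addC contra_hom_add0 contra_hom_addN.

End HomGroup.

(* R as the free contramodule with one generator: \sum_t r_t t is the limit of the
   finite partial sums computed in R. *)
Definition ring_contra_act (r : fcomb R R) : R := infsum setT (fun x => r x * x).

Lemma ring_contra_bind X (k : X -> fcomb R R) (r : fcomb R X) :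
  ring_contra_act (fcomb_bind k r) = infsum setT (fun x => r x * ring_contra_act (k x)).
Proof.
rewrite /ring_contra_act /= -!/(isum _).
have -> : (fun x => r x * infsum setT (fun y => k x y * y)) =
          (fun x => isum (fun y => r x * (k x y * y))).
  by apply/funext => x; rewrite isumMl//; exact: zero_familyMr (fcoefP _).
rewrite isum_exchange.
  congr isum; apply/funext => y; rewrite -/(isum _) -isumMr.
    by congr isum; apply/funext => x; rewrite mulrA.
  exact: zero_family2_in (zero_family2C (zero_family2_bind r k)) y.
move=> I Io; have [t [u H]] := zero_family2_bind r k Io.
by exists t, u => x y /H; rewrite mulrA; exact: ideal_mulr.
Qed.

Fact ring_contra_unit a : ring_contra_act (fcomb_unit a) = a.
Proof.
rewrite /ring_contra_act /= -/(isum _) (@isum_single _ _ _ a).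
  by rewrite asboolT// mul1r.
by move=> b ab; rewrite asboolF ?mul0r// => /esym.
Qed.

Fact ring_contra_assoc (r : fcomb R (fcomb R R)) :
  ring_contra_act (fcomb_map ring_contra_act r) = ring_contra_act (fcomb_join r).
Proof.
rewrite fcomb_joinE fcomb_mapE !ring_contra_bind; congr infsum.
by apply/funext => x /=; rewrite ring_contra_unit.
Qed.

Definition ring_contra : contramodule R :=
  Contramodule (ContraStructure ring_contra_unit ring_contra_assoc).

End Contramodule.

Section Proflat.
Variables (R S : topologicalRingType) (f : continuousRMorphism R S).

(* The closure of f(I)S in S. *)
Definition extended_ideal_closure (I : set R) : set S :=
  closure (right_ideal_generated (f @` I)).

Definition strongly_right_taut : Prop :=
  zero_base [set I : set R | is_open_two_sided_ideal I /\
                             is_open_two_sided_ideal (extended_ideal_closure I)].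

Lemma extended_ideal_closure_sub (I : two_sided_ideal R) (J : two_sided_ideal S) :
  subgroup_set J = extended_ideal_closure (subgroup_set I) ->
  forall x, subgroup_set I x -> subgroup_set J (f x).
Proof.
move=> -> x Ix; apply: subset_closure; apply: sub_gen_smallest.
by exists x.
Qed.

(* The last clause says that S/J is a flat left R/I-module, where J is the
   closure of f(I)S; fIJ only serves to define the R/I-module S/J. *)
Definition left_proflat : Prop :=
  strongly_right_taut /\
  forall (I : two_sided_ideal R) (J : two_sided_ideal S)
    (IJ : subgroup_set J = extended_ideal_closure (subgroup_set I)),
    open (subgroup_set I) -> open (subgroup_set J) ->
    flat_left_module (quotient_module (extended_ideal_closure_sub IJ)).

End Proflat.

Section Restriction.
Variables (R S : completeLinearRingType) (f : continuousRMorphism R S).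

Definition fcomb_scalars X (r : fcomb R X) : fcomb S X :=
  FComb (zero_family_morph f (fcoefP r)).

Lemma fcomb_scalars_unit X (x : X) : fcomb_scalars (fcomb_unit x) = fcomb_unit x.
Proof.
by apply: fcomb_eq => y /=; case: asboolP => _; rewrite ?rmorph1 ?rmorph0.
Qed.

Lemma fcomb_scalars_bind X Y (k : X -> fcomb R Y) (r : fcomb R X) :
  fcomb_scalars (fcomb_bind k r) =
  fcomb_bind (fun x => fcomb_scalars (k x)) (fcomb_scalars r).
Proof.
apply: fcomb_eq => y /=; rewrite -!/(isum _) isum_morph; last first.
  exact: zero_familyMr (fcoefP r).
by congr isum; apply/funext => x; rewrite rmorphM.
Qed.

Lemma fcomb_scalars_map X Y (g : X -> Y) (r : fcomb R X) :
  fcomb_scalars (fcomb_map g r) = fcomb_map g (fcomb_scalars r).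
Proof.
rewrite !fcomb_mapE fcomb_scalars_bind; congr (fcomb_bind _ (fcomb_scalars r)).
by apply/funext => x /=; rewrite fcomb_scalars_unit.
Qed.

Section Object.
Variable Q : contramodule S.

Definition restrict_act (r : fcomb R Q) : Q := cact (fcomb_scalars r).

Fact restrict_unit q : restrict_act (fcomb_unit q) = q.
Proof. by rewrite /restrict_act fcomb_scalars_unit cact_unit. Qed.

Fact restrict_assoc (r : fcomb R (fcomb R Q)) :
  restrict_act (fcomb_map restrict_act r) = restrict_act (fcomb_join r).
Proof.
rewrite /restrict_act fcomb_joinE fcomb_scalars_bind fcomb_scalars_map.
by rewrite cact_bind.
Qed.

Definition restrict : contramodule R :=
  Contramodule (ContraStructure restrict_unit restrict_assoc).

End Object.

Fact restrict_hom_subproof (Q Q' : contramodule S) (h : contra_hom Q Q') :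
  @is_contra_hom R (restrict Q) (restrict Q') h.
Proof.
by move=> r; rewrite [LHS]contra_homP -fcomb_scalars_map.
Qed.

Definition restrict_hom (Q Q' : contramodule S) (h : contra_hom Q Q') :
  contra_hom (restrict Q) (restrict Q') := ContraHom (restrict_hom_subproof h).

Fact mulr_contra_hom_subproof (s : S) :
  @is_contra_hom S (ring_contra S) (ring_contra S) (fun t : S => t * s).
Proof.
move=> r; rewrite fcomb_mapE.
transitivity (infsum setT (fun t => r t * (t * s))); last first.
  rewrite [RHS]ring_contra_bind; congr infsum.
  by apply/funext => t /=; rewrite ring_contra_unit.
rewrite [LHS]/= /ring_contra_act -!/(isum _) -isumMr.
  by congr isum; apply/funext => t; rewrite mulrA.
exact: zero_familyMr (fcoefP r).
Qed.

Definition mulr_contra_hom (s : S) : contra_hom (ring_contra S) (ring_contra S) :=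
  ContraHom (mulr_contra_hom_subproof s).

Fact ring_hom_subproof :
  @is_contra_hom R (ring_contra R) (restrict (ring_contra S)) f.
Proof.
move=> r.
transitivity (ring_contra_act (fcomb_scalars (fcomb_map f r))); last by [].
rewrite fcomb_scalars_map fcomb_mapE [RHS]ring_contra_bind [LHS]isum_morph; last first.
  exact: zero_familyMr (fcoefP r).
congr infsum; apply/funext => x /=.
by rewrite ring_contra_unit rmorphM.
Qed.

(* f as a morphism of left R-contramodules from R to S. *)
Definition ring_hom : contra_hom (ring_contra R) (restrict (ring_contra S)) :=
  ContraHom ring_hom_subproof.

Section Coextension.
Variable P : contramodule R.

Definition coext : Type := contra_hom (restrict (ring_contra S)) P.
HB.instance Definition _ := GRing.Zmodule.on coext.

(* (s h)(t) = h(t s) *)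
Definition coext_scale (s : S) (h : coext) : coext :=
  contra_hom_comp h (restrict_hom (mulr_contra_hom s)).

Fact coext_scaleA s t h : coext_scale s (coext_scale t h) = coext_scale (s * t) h.
Proof. by apply: contra_hom_eq => u /=; rewrite mulrA. Qed.
Fact coext_scale1 : left_id 1 coext_scale.
Proof. by move=> h; apply: contra_hom_eq => u /=; rewrite mulr1. Qed.
Fact coext_scaleDr : right_distributive coext_scale +%R.
Proof. by move=> s g h; apply: contra_hom_eq. Qed.
Fact coext_scaleDl h : {morph coext_scale^~ h : s t / s + t}.
Proof.
move=> s t; apply: contra_hom_eq => u /=; rewrite mulrDr.
rewrite -[RHS](contra_homD h); congr (contra_hom_fun h _).
rewrite [RHS]/GRing.add /= /contra_add [RHS]/cact /= /restrict_act.
rewrite /cact /= /ring_contra_act -/(isum _).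
transitivity (isum (fun x => fcomb_unit (R := S) (u * s) x * x +
                         fcomb_unit (R := S) (u * t) x * x)).
  rewrite isumD; try exact: zero_familyMr (fcoefP _).
  by congr (_ + _); rewrite -[LHS](ring_contra_unit).
congr isum; apply/funext => x /=.
by rewrite rmorphD -mulrDl; do 2 case: asboolP => _; rewrite ?rmorph1 ?rmorph0.
Qed.
HB.instance Definition _ := GRing.Zmodule_isLmodule.Build S coext
  coext_scaleA coext_scale1 coext_scaleDr coext_scaleDl.

End Coextension.

(* The functoriality of Hom(S,P) in P. *)
Definition coext_map (P P' : contramodule R) (g : contra_hom P P')
    (h : coext P) : coext P' := contra_hom_comp g h.

(* Hom(S,P) -> Hom(R,P) -> P, composition with f followed by evaluation at 1 *)
Definition coext_eval (P : contramodule R) (h : coext P) : P :=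
  contra_hom_comp h ring_hom (1 : R).

End Restriction.

Record category := Category {
  ob :> Type;
  mor : ob -> ob -> Type;
  idm : forall x, mor x x;
  compm : forall x y z, mor y z -> mor x y -> mor x z;
  compm_idl : forall x y (g : mor x y), compm (idm y) g = g;
  compm_idr : forall x y (g : mor x y), compm g (idm x) = g;
  compmA : forall x y z w (k : mor z w) (h : mor y z) (g : mor x y),
    compm k (compm h g) = compm (compm k h) g }.
Arguments mor {c} x y.
Arguments idm {c} x.
Arguments compm {c x y z} h g.

Record functor (C D : category) := Functor {
  fob :> C -> D;
  fmor : forall x y, mor x y -> mor (fob x) (fob y);
  fmor_id : forall x, fmor (idm x) = idm (fob x);
  fmor_comp : forall x y z (h : mor y z) (g : mor x y),
    fmor (compm h g) = compm (fmor h) (fmor g) }.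
Arguments fmor {C D} F {x y} g : rename.

(* adjunction L G : L is left adjoint to G *)
Record adjunction (C D : category) (L : functor D C) (G : functor C D) := Adjunction {
  adj : forall (y : D) (x : C), mor (L y) x -> mor y (G x);
  adj_inv : forall (y : D) (x : C), mor y (G x) -> mor (L y) x;
  adjK : forall y x, cancel (@adj y x) (@adj_inv y x);
  adj_invK : forall y x, cancel (@adj_inv y x) (@adj y x);
  adj_naturall : forall (y y' : D) (x : C) (k : mor y' y) (g : mor (L y) x),
    adj (compm g (fmor L k)) = compm (adj g) k;
  adj_naturalr : forall (y : D) (x x' : C) (h : mor x x') (g : mor (L y) x),
    adj (compm h g) = compm (fmor G h) (adj g) }.

Definition counit (C D : category) (L : functor D C) (G : functor C D)
    (a : adjunction L G) (x : C) : mor (L (G x)) x :=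
  adj_inv a (idm (G x)).

Section ContraCategory.
Variable R : completeLinearRingType.

Fact contra_compl (P Q : contramodule R) (g : contra_hom P Q) :
  contra_hom_comp (contra_hom_id Q) g = g.
Proof. exact: contra_hom_eq. Qed.
Fact contra_compr (P Q : contramodule R) (g : contra_hom P Q) :
  contra_hom_comp g (contra_hom_id P) = g.
Proof. exact: contra_hom_eq. Qed.
Fact contra_compA (P Q M N : contramodule R) (k : contra_hom M N)
    (h : contra_hom Q M) (g : contra_hom P Q) :
  contra_hom_comp k (contra_hom_comp h g) = contra_hom_comp (contra_hom_comp k h) g.
Proof. exact: contra_hom_eq. Qed.

Definition Contra : category :=
  Category contra_compl contra_compr contra_compA.

End ContraCategory.

Section Functors.
Variables (R S : completeLinearRingType) (f : continuousRMorphism R S).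

Fact restrict_functor_id (Q : Contra S) : restrict_hom f (contra_hom_id Q) =
  contra_hom_id (restrict f Q).
Proof. exact: contra_hom_eq. Qed.
Fact restrict_functor_comp (Q Q' Q'' : Contra S) (h : contra_hom Q' Q'')
    (g : contra_hom Q Q') : restrict_hom f (contra_hom_comp h g) =
  contra_hom_comp (restrict_hom f h) (restrict_hom f g).
Proof. exact: contra_hom_eq. Qed.

Definition restrict_functor : functor (Contra S) (Contra R) :=
  @Functor (Contra S) (Contra R) (restrict f) (restrict_hom f)
    restrict_functor_id restrict_functor_comp.

(* S-contramodule structures gamma on the sets Hom(S,P), functorial in P, make
   P |-> Hom(S,P) a functor to S-contramodules. *)
Definition coext_contra (gamma : forall P : contramodule R,
    contra_structure S (coext f P)) (P : contramodule R) : contramodule S :=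
  Contramodule (gamma P).

(* The identity, between Hom(S,P) with the S-module underlying gamma P and
   Hom(S,P) with its own S-module structure. *)
Definition coext_contra_id (gamma : forall P : contramodule R,
    contra_structure S (coext f P)) (P : contramodule R)
    (h : coext_contra gamma P) : coext f P := h.

Definition coext_functorial (gamma : forall P : contramodule R,
    contra_structure S (coext f P)) : Prop :=
  forall (P P' : contramodule R) (g : contra_hom P P'),
    @is_contra_hom S (coext_contra gamma P) (coext_contra gamma P') (coext_map g).

Variables (gamma : forall P : contramodule R, contra_structure S (coext f P))
  (gammaF : coext_functorial gamma).

Definition coext_hom (P P' : contramodule R) (g : contra_hom P P') :
  contra_hom (coext_contra gamma P) (coext_contra gamma P') :=
  ContraHom (gammaF g).

Fact coext_functor_id (P : Contra R) : coext_hom (contra_hom_id P) =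
  contra_hom_id (coext_contra gamma P).
Proof. by apply: contra_hom_eq => h; exact: contra_hom_eq. Qed.
Fact coext_functor_comp (P P' P'' : Contra R) (h : contra_hom P' P'')
    (g : contra_hom P P') : coext_hom (contra_hom_comp h g) =
  contra_hom_comp (coext_hom h) (coext_hom g).
Proof. by apply: contra_hom_eq => k; exact: contra_hom_eq. Qed.

Definition coext_functor : functor (Contra R) (Contra S) :=
  @Functor (Contra R) (Contra S) (coext_contra gamma) coext_hom
    coext_functor_id coext_functor_comp.

End Functors.

(* Main.v *)
(** The point is that [f_sharp] sends the free [S]-contramodule [S[[X]]] to the coproduct of
    [X] copies of the [R]-contramodule [S].  Hence every family of morphisms [h x : S -> P]
    extends uniquely to [S[[X]] -> P]; for the tautological family on [X = Hom(S, P)] this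
    is a summation map [H], and [r] acts on [Hom(S, P)] by [s |-> H (s r)].  All the axioms
    and the adjunction then follow from the uniqueness of extensions.

    Choose a decreasing countable base of open ideals [I_n] of [R] such that the closures
    [J_n] of [f(I_n)S] are open ideals.  By successive approximation every element of [J_n]
    is a sum [sum_i f(r_i) s_i] with [r_i] in [I_n] converging to zero; so the elements
    [s x] generate [S[[X]]].  Flatness of [S/J_m] over [R/I_m] makes the inclusion of
    [I_n/I_m] in [R/I_m] injective after tensoring with [S/J_m], so the kernel [K] of
    [R[[S]] -> S] is pure modulo [I_m]; by successive approximation again, every element of
    [K] with coefficients in [I_n] is a zero-convergent combination of elements of [K] with
    coefficients in [I_n].  A relation between the [s x] in [S[[X]]] is a family of elements
    of [K], indexed by [X] and converging to zero; this rewrites it as one zero-convergent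
    combination of elements of [K], each of which any morphism [S -> P] sends to zero.
    (Annihilating each member of the family separately would not be enough, as contramodules
    need not be separated.) *)

Require Import Defs.
From HB Require Import structures.
From mathcomp Require Import all_boot all_algebra.
From mathcomp Require Import boolp classical_sets topology.
From mathcomp Require Import cardinality.

Set Implicit Arguments.
Unset Strict Implicit.
Unset Printing Implicit Defensive.
Import GRing.Theory.
Local Open Scope ring_scope.

(** * Double families converging to zero, and combinations with coefficients in an ideal *)

Section FormalCombinations.
Variable R : completeLinearRingType.
Implicit Types (X Y : Type) (I : two_sided_ideal R).

(** Modulo [I] only the finitely many rows in [t] survive, and each of them has finitely many
    entries outside [I]. *)
Lemma zero_family2_by_rows X Y (r : X -> Y -> R) :
  (forall I, open (subgroup_set I) -> exists t : seq {classic X},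
    forall x y, (x : {classic X}) \notin t -> subgroup_set I (r x y)) ->
  (forall x, zero_family (r x)) -> zero_family2 r.
Proof.
move=> rows r0 I Io; have [t tI] := rows I Io.
have rI x : exists u : seq {classic Y}, forall y,
    (y : {classic Y}) \notin u -> subgroup_set I (r x y).
  by have [u _ uI] := zero_family_seq Io (r0 x); exists u.
have [u uI] := choice rI.
exists t, (flatten [seq u x | x : {classic X} <- t]) => x y xy.
have [xt|/tI//] := boolP ((x : {classic X}) \in t).
case: xy => [/negP//|yu]; apply/uI; apply: contra yu => yu.
by apply/flattenP; exists (u x) => //; apply/mapP; exists (x : {classic X}).
Qed.

Lemma zero_family_pair X Y (r : X -> Y -> R) :
  zero_family2 r -> zero_family (fun p => r p.1 p.2).
Proof.
move=> r0; apply: zero_familyI => I /r0[t [u H]].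
exists [seq ((x, y) : {classic X * Y}) | x : {classic X} <- t, y : {classic Y} <- u].
move=> [x y] /= xy; apply: H.
case: (boolP ((x : {classic X}) \in t)) => [xt|]; last by left.
by right; apply: contra xy => yu; apply/allpairsP; exists (x, y).
Qed.

Lemma zero_family_curry X Y (r : X * Y -> R) :
  zero_family r -> zero_family2 (fun x y => r (x, y)).
Proof.
move=> r0 I Io; have [t _ tI] := zero_family_seq Io r0.
exists [seq (p.1 : {classic X}) | p : {classic X * Y} <- t].
exists [seq (p.2 : {classic Y}) | p : {classic X * Y} <- t].
move=> x y xy; apply: tI; apply/negP => xyt.
by case: xy => /negP[]; apply/mapP; exists (x, y).
Qed.

(** Modulo an open ideal both sides are the same finite sum over a rectangle. *)
Lemma isum_pair X Y (r : X -> Y -> R) : zero_family2 r ->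
  isum (fun p : X * Y => r p.1 p.2) = isum (fun x => isum (r x)).
Proof.
move=> r0; apply: eq_mod_open => I Io; have [t [u H]] := r0 I Io.
have {}H x y : (x : {classic X}) \notin undup t \/ (y : {classic Y}) \notin undup u ->
    subgroup_set I (r x y) by rewrite !mem_undup; exact: H.
have h1 := isum_double r0 Io (undup_uniq t) (undup_uniq u) H.
pose tu := [seq ((x, y) : {classic X * Y}) | x : {classic X} <- undup t,
                                            y : {classic Y} <- undup u].
have utu : uniq tu.
  by apply: allpairs_uniq; rewrite ?undup_uniq// => -[? ?] [? ?] _ _ [-> ->].
have tuI (p : X * Y) : (p : {classic X * Y}) \notin tu -> subgroup_set I (r p.1 p.2).
  case: p => x y /= xy; apply: H.
  case: (boolP ((x : {classic X}) \in undup t)) => [xt|]; last by left.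
  by right; apply: contra xy => yu; apply/allpairsP; exists (x, y).
have := isum_mod Io (zero_family_pair r0) utu tuI.
rewrite big_allpairs_dep /= => h2.
rewrite -(subrK (\sum_(x <- undup t) \sum_(y <- undup u) r x y) (isum _)) -addrA.
by apply: subgroupD => //; rewrite -opprB; exact: subgroupN.
Qed.

Lemma isum0 X : isum (fun _ : X => 0 : R) = 0.
Proof.
have r0 := @fcomb_zero_subproof R X.
by apply: (addrI (isum (fun _ : X => 0 : R))); rewrite -isumD // !addr0.
Qed.

Definition fcomb_in I X (r : fcomb R X) : Prop := forall x, subgroup_set I (r x).

Lemma fcomb_in_bind I X Y (k : X -> fcomb R Y) (r : fcomb R X) :
  open (subgroup_set I) -> fcomb_in I r -> fcomb_in I (fcomb_bind k r).
Proof.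
move=> Io rI y; apply: isum_in => //; last by move=> x; exact: ideal_mulr.
exact: zero_familyMr (fcoefP r).
Qed.

Lemma fcomb_in0 I X : fcomb_in I (0 : fcomb R X).
Proof. by move=> x; exact: subgroup0. Qed.

Lemma fcomb_inD I X (r s : fcomb R X) :
  fcomb_in I r -> fcomb_in I s -> fcomb_in I (r + s).
Proof. by move=> rI sI x; exact: subgroupD. Qed.

Lemma fcomb_inN I X (r : fcomb R X) : fcomb_in I r -> fcomb_in I (- r).
Proof. by move=> rI x; apply: ideal_mull. Qed.

Lemma fcomb_inB I X (r s : fcomb R X) :
  fcomb_in I r -> fcomb_in I s -> fcomb_in I (r - s).
Proof. by move=> rI sI; apply/fcomb_inD/fcomb_inN. Qed.

Lemma fcomb_inZ I X a (r : fcomb R X) : subgroup_set I a -> fcomb_in I (a *: r).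
Proof. by move=> Ia x; exact: ideal_mulr. Qed.

Lemma fcomb_inZr I X a (r : fcomb R X) : fcomb_in I r -> fcomb_in I (a *: r).
Proof. by move=> rI x; exact: ideal_mull. Qed.

Lemma fcomb_sumE X (T : Type) (s : seq T) (F : T -> fcomb R X) x :
  (\sum_(i <- s) F i) x = \sum_(i <- s) F i x.
Proof.
by elim: s => [|i s IH]; rewrite ?big_nil// !big_cons -IH.
Qed.

Lemma fcomb_eq0_mod X (r : fcomb R X) :
  (forall I, open (subgroup_set I) -> fcomb_in I r) -> r = 0.
Proof.
move=> rI; apply: fcomb_eq => x; apply: eq_mod_open => I Io.
by rewrite subr0; exact: rI.
Qed.

Lemma cact_map_const0 X (P : contramodule R) (r : fcomb R X) :
  cact (fcomb_map (fun=> 0 : P) r) = 0.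
Proof.
have := cact_bind (fun _ : X => 0 : fcomb R P) r.
by rewrite fcomb_bind_zero.
Qed.

End FormalCombinations.

(** Finite supports are lists over [{classic T}], whose equality test is not that of [T]; this
    transfers facts about [iota] to them. *)
Lemma mem_classic (T : eqType) (x : T) (s : seq T) :
  ((x : {classic T}) \in (s : seq {classic T})) = (x \in s).
Proof.
elim: s => [//|y s IH]; rewrite !inE IH; congr (_ || _).
by apply/eqP/eqP.
Qed.

Lemma uniq_classic (T : eqType) (s : seq T) : uniq (s : seq {classic T}) = uniq s.
Proof. by elim: s => //= x s ->; rewrite mem_classic. Qed.

(** * Successive approximation along a filtration *)

Section Approximation.
Variable R : completeLinearRingType.
Variable I : nat -> two_sided_ideal R.
Hypothesis I_open : forall n, open (subgroup_set (I n)).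
Hypothesis I_base : forall J : two_sided_ideal R, open (subgroup_set J) ->
  exists n, forall m, (n <= m)%N -> forall x, subgroup_set (I m) x -> subgroup_set J x.
Hypothesis I_dec : forall m n, (m <= n)%N -> forall x,
  subgroup_set (I n) x -> subgroup_set (I m) x.

Lemma zero_family2_nat X (r : nat -> fcomb R X) N :
  (forall j, fcomb_in (I (N + j)) (r j)) -> zero_family2 (fun j x => r j x).
Proof.
move=> rI; apply: zero_family2_by_rows => [J Jo|j]; last exact: fcoefP.
have [n nJ] := I_base Jo; exists (iota 0 n : seq {classic nat}) => j x jn.
apply: (nJ (N + j)%N); last exact: rI.
rewrite (leq_trans _ (leq_addl N j))// leqNgt; apply: contra jn => jn.
by rewrite mem_classic mem_iota.
Qed.

Variables (T : Type) (M : zmodType) (Phi : fcomb R T -> M).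
Hypothesis PhiD : forall r s, Phi (r + s) = Phi r + Phi s.
Variable Mn : nat -> subgroup M.
Hypothesis Mn_sep : forall x, (forall n, subgroup_set (Mn n) x) -> x = 0.
Hypothesis Mn_dec : forall m n, (m <= n)%N -> forall x,
  subgroup_set (Mn n) x -> subgroup_set (Mn m) x.
Hypothesis PhiM : forall n r, fcomb_in (I n) r -> subgroup_set (Mn n) (Phi r).
Hypothesis Phi_step : forall n x, subgroup_set (Mn n) x ->
  exists2 r, fcomb_in (I n) r & subgroup_set (Mn n.+1) (x - Phi r).

Let Phi0 : Phi 0 = 0.
Proof. by apply: (addrI (Phi 0)); rewrite -PhiD !addr0. Qed.

Let PhiN r : Phi (- r) = - Phi r.
Proof. by apply: (addrI (Phi r)); rewrite -PhiD !subrr. Qed.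

Let PhiB r s : Phi (r - s) = Phi r - Phi s.
Proof. by rewrite PhiD PhiN. Qed.

(** Corrections are subtracted one by one: the remainder [y j] lies in [Mn (N + j)], so its
    correction [rho j] has coefficients in [I (N + j)]. The corrections are thus summable in
    [fcomb R T], and [Phi] of the sum differs from [x] by an element of every [Mn n]. *)
Lemma approx_from N x : subgroup_set (Mn N) x ->
  exists2 r, fcomb_in (I N) r & Phi r = x.
Proof.
move=> xN.
(* The dummy value 0 makes the correction total, as [choice] requires. *)
have step (p : nat * M) : exists r, subgroup_set (Mn p.1) p.2 ->
    fcomb_in (I p.1) r /\ subgroup_set (Mn p.1.+1) (p.2 - Phi r).
  have [/Phi_step[r rI rM]|nM] := pselect (subgroup_set (Mn p.1) p.2).
    by exists r.
  by exists 0.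
have [c cP] := choice step.
pose y := fix y j := if j is i.+1 then y i - Phi (c ((N + i)%N, y i)) else x.
pose rho j := c ((N + j)%N, y j).
have yM j : subgroup_set (Mn (N + j)%N) (y j).
  elim: j => [|j IH] /=; first by rewrite addn0.
  by rewrite addnS; exact: (cP ((N + j)%N, y j) IH).2.
have rhoI j : fcomb_in (I (N + j)%N) (rho j) by exact: (cP ((N + j)%N, y j) (yM j)).1.
have r0 := zero_family2_nat rhoI.
pose r := FComb (zero_family2_out (zero_family2C r0)).
have yE j : y j = x - Phi (\sum_(i < j) rho i).
  elim: j => [|j IH] /=; first by rewrite big_ord0 Phi0 subr0.
  by rewrite big_ord_recr/= PhiD opprD addrA -IH.
have tailI n : fcomb_in (I (N + n)%N) (r - \sum_(i < n) rho i).
  move=> t; rewrite -(big_mkord xpredT rho) /index_iota subn0.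
  rewrite /GRing.add/= /fcomb_opp/= mulN1r fcomb_sumE.
  have := @isum_mod R nat (fun j => rho j t) (I (N + n)%N) (iota 0 n).
  apply => //.
  - exact: zero_family2_in (zero_family2C r0) t.
  - by rewrite uniq_classic iota_uniq.
  - move=> j jn; apply: (@I_dec _ (N + j)); last exact: rhoI.
    rewrite leq_add2l leqNgt; apply: contra jn => jn.
    by rewrite mem_classic mem_iota.
exists r.
  by have := tailI 0%N; rewrite addn0 big_ord0 subr0.
apply/eqP; rewrite -subr_eq0; apply/eqP; apply: Mn_sep => n.
apply: (Mn_dec (leq_addl N n)).
rewrite -(subrK (Phi (\sum_(i < n) rho i)) (Phi r)) -addrA; apply: subgroupD.
  by rewrite -PhiB; exact: PhiM.
by rewrite -opprB -yE; exact: subgroupN.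
Qed.

(** One preimage serves every [n] at once: a nonzero [x] has a last [N] with [x] in [Mn N], from
    which the approximation starts; for [x = 0] it is 0. *)
Lemma approx x : subgroup_set (Mn 0) x ->
  exists2 r, Phi r = x & forall n, subgroup_set (Mn n) x -> fcomb_in (I n) r.
Proof.
move=> x0; have [->|/eqP xn0] := pselect (x = 0).
  by exists 0 => [//|n _]; exact: fcomb_in0.
have ex : exists n, `[< ~ subgroup_set (Mn n) x >].
  apply: contrapT => /forallNP xM; apply: (negP xn0); apply/eqP/Mn_sep => n.
  by apply: contrapT => nx; apply: (xM n); exact/asboolP.
case: (ex_minnP ex) => -[/asboolP//|N] /asboolP NP Nmin.
have xN : subgroup_set (Mn N) x.
  apply: contrapT => /asboolP/Nmin; by rewrite ltnn.
have [r rI rx] := approx_from xN; exists r => // n xn.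
apply: (fun h t => @I_dec n N h _ (rI t)); rewrite leqNgt; apply/negP => Nn.
exact/NP/(Mn_dec Nn).
Qed.

End Approximation.

Section WholeIdeal.
Variable R : pzRingType.

Fact whole_subgroupB (x y : R) :
  [set: R]%classic x -> [set: R]%classic y -> [set: R]%classic (x - y).
Proof. by []. Qed.

Definition whole_ideal : two_sided_ideal R :=
  @TwoSidedIdeal R (@Subgroup R setT I whole_subgroupB)
    (fun _ _ _ => I) (fun _ _ _ => I).

End WholeIdeal.

(** * A decreasing sequence of ideals adapted to [f] *)

Section TautSequence.
Variables (R S : completeLinearRingType) (f : continuousRMorphism R S).

Lemma gen_in_closure (A : set R) a (s : S) :
  A a -> extended_ideal_closure f A (f a * s).
Proof.
move=> Aa; apply: subset_closure => K [[K0 KB KM] /= fA].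
by apply/KM/fA; exists a.
Qed.

(** An open subgroup is closed: a point of the closure is congruent modulo [J] to some [z] in the
    right ideal generated by [f(A)], and [z] lies in [J]. *)
Lemma extended_closure_sub (A : set R) (J : two_sided_ideal S) :
  open (subgroup_set J) -> (forall a, A a -> subgroup_set J (f a)) ->
  forall s, extended_ideal_closure f A s -> subgroup_set J s.
Proof.
move=> Jo fA s /(_ _ (nbhs_shift s (@open_subgroup_nbhs S (OpenSubgroup Jo)))).
move=> [z [/= zA zJ]]; rewrite -(subrK z s) -opprB; apply: subgroupD.
  exact: subgroupN.
apply: (zA (subgroup_set J)); split; last by move=> _ [a Aa <-]; exact: fA.
split; [exact: subgroup0|exact: subgroupB|exact: ideal_mulr].
Qed.

(** Tautness gives an admissible ideal inside any neighborhood of zero; it is applied recursively to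
    the previous ideal intersected with the next member of the countable base. *)
Lemma taut_sequence : countable_zero_base R -> strongly_right_taut f ->
  exists (I : nat -> two_sided_ideal R) (J : nat -> two_sided_ideal S),
  [/\ (forall n, open (subgroup_set (I n))) /\ (forall n, open (subgroup_set (J n))),
      forall n, subgroup_set (J n) = extended_ideal_closure f (subgroup_set (I n)),
      forall x, subgroup_set (I 0%N) x,
      forall n x, subgroup_set (I n.+1) x -> subgroup_set (I n) x &
      forall V : set R, nbhs 0 V -> exists n, subset (subgroup_set (I n)) V].
Proof.
move=> [B /countable_injP[g gI] [B0 Bbase]] taut.
have step (V : set R) : exists K : two_sided_ideal R, nbhs 0 V ->
    [/\ open (subgroup_set K), subset (subgroup_set K) V &
        is_open_two_sided_ideal (extended_ideal_closure f (subgroup_set K))].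
  have [V0|nV] := pselect (nbhs (0 : R) V); last by exists (whole_ideal R).
  by have [A [[Ao [K AK]] KS] KV] := taut.2 _ V0; exists K; rewrite -AK.
have [c cP] := choice step.
(* The base is enumerated along the injection [g]; indices outside its image get the whole ring,
   which imposes no condition. *)
pose b n : set R := xget setT [set A | B A /\ g A = n]%classic.
have b0 n : nbhs (0 : R) (b n).
  by rewrite /b; case: xgetP => [A _ [/B0]//|_]; exact: filterT.
(* Starting from the whole ring puts every element at level 0 of the filtration. *)
pose I := fix I n := if n is m.+1
  then c (subgroup_set (I m) `&` b m)%classic else whole_ideal R.
have Io n : open (subgroup_set (I n)) /\
    is_open_two_sided_ideal (extended_ideal_closure f (subgroup_set (I n))).
  elim: n => [|n [IHo _]] /=.
    split; first exact: openT.
    have -> : extended_ideal_closure f (subgroup_set (whole_ideal R)) = setT.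
      rewrite -subTset => s _; rewrite -[s]mul1r -(rmorph1 f).
      exact: gen_in_closure.
    split; first exact: openT.
    by exists (whole_ideal S).
  have /cP[] // : nbhs (0 : R) (subgroup_set (I n) `&` b n)%classic.
  apply: filterI; [exact: (@open_subgroup_nbhs R (OpenSubgroup IHo))|exact: b0].
have In n : subset (subgroup_set (I n.+1)) (subgroup_set (I n) `&` b n)%classic.
  have /cP[] // : nbhs (0 : R) (subgroup_set (I n) `&` b n)%classic.
  apply: filterI; [exact: (@open_subgroup_nbhs R (OpenSubgroup (Io n).1))|exact: b0].
have Jex n : exists J : two_sided_ideal S,
    extended_ideal_closure f (subgroup_set (I n)) = subgroup_set J.
  by have [_ [_]] := Io n.
have [J JE] := choice Jex.
exists I, J; split.
- by split=> n; [exact: (Io n).1|rewrite -JE; exact: (Io n).2.1].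
- by move=> n; rewrite JE.
- by [].
- by move=> n x /In[].
- move=> V /Bbase[A BA AV]; exists (g A).+1 => x /In[_ bx]; apply: AV.
  suff <- : b (g A) = A by [].
  rewrite /b; case: xgetP => [A' _ [BA' gA']|/(_ A)]; last by case; split.
  by apply: gI => //; rewrite inE.
Qed.

End TautSequence.

(** * The ideal [A/B] as a right module over [R/B] *)

Section IdealModule.
Variables (R : pzRingType) (A B : two_sided_ideal R).
Hypothesis BA : forall x, subgroup_set B x -> subgroup_set A x.

(** Right modules are left modules over the converse ring, so this is [R/B] as a right module over
    itself. *)
Let V : lmodType (quotient_ring B)^c := (quotient_ring B)^c^o.

Definition quotient_repr (q : quotient_ring B) : R :=
  repr (q : Quotient.quot (subgroup_zmod B)).

Lemma quotient_reprK q : quotient_ring_proj B (quotient_repr q) = q.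
Proof. by rewrite /quotient_ring_proj /quotient_proj reprK. Qed.

Lemma quotient_repr_proj x :
  subgroup_set B (quotient_repr (quotient_ring_proj B x) - x).
Proof. by apply/quotient_projP; exact: quotient_reprK. Qed.

Lemma quotient_repr_eq q x :
  q = quotient_ring_proj B x -> subgroup_set B (quotient_repr q - x).
Proof. by move=> ->; exact: quotient_repr_proj. Qed.

Lemma quotient_ring_proj0 : quotient_ring_proj B 0 = 0.
Proof.
apply: (addrI (quotient_ring_proj B 0)).
by rewrite addr0 -[LHS]quotient_projD addr0.
Qed.

(* A / B as a right R / B-module; it mentions BA, which the module structure needs. *)
Definition quotient_ideal_pred : {pred V} :=
  let _ := BA in fun q => `[< subgroup_set A (quotient_repr q) >].

Lemma quotient_ideal_predE x :
  (quotient_ring_proj B x : V) \in quotient_ideal_pred <-> subgroup_set A x.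
Proof.
have Ax := BA (quotient_repr_proj x).
split=> [/asboolP Ap|xA]; last apply/asboolP.
  by rewrite -(subKr (quotient_repr (quotient_ring_proj B x)) x); apply: subgroupB.
by rewrite -(subrK x (quotient_repr _)); apply: subgroupD.
Qed.

Lemma quotient_ideal_submod_closed : submod_closed quotient_ideal_pred.
Proof.
split=> [|a u v].
  rewrite -[0]/(0 : quotient_ring B) -quotient_ring_proj0.
  exact/quotient_ideal_predE/subgroup0.
have [[x ->] [y ->]] := (quotient_ring_proj_surj u, quotient_ring_proj_surj v).
have [z ->] := quotient_ring_proj_surj a.
move=> /quotient_ideal_predE xA /quotient_ideal_predE yA.
have -> : (quotient_ring_proj B z : (quotient_ring B)^c) *: (quotient_ring_proj B x : V) +
    quotient_ring_proj B y = quotient_ring_proj B (x * z + y).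
  rewrite [RHS]quotient_projD; congr (_ + _).
  exact: quotient_ring_mulE.
by apply/quotient_ideal_predE/subgroupD => //; exact: ideal_mulr.
Qed.

HB.instance Definition _ := GRing.isSubmodClosed.Build (quotient_ring B)^c V
  quotient_ideal_pred quotient_ideal_submod_closed.

Record quotient_ideal := QuotientIdeal {
  quotient_ideal_val : V;
  quotient_idealP : quotient_ideal_val \in quotient_ideal_pred }.

HB.instance Definition _ := [isSub for quotient_ideal_val].
HB.instance Definition _ := [Choice of quotient_ideal by <:].
HB.instance Definition _ := [SubChoice_isSubLmodule of quotient_ideal by <:].

End IdealModule.

(** * The evaluation [R[[S]] -> S] and its kernel *)

Section ScalarEval.
Variables (R S : completeLinearRingType) (f : continuousRMorphism R S).

(** This is the structure map of [S] as an [R]-contramodule by restriction along [f]. *)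
Definition scalar_eval (r : fcomb R S) : S := isum (fun s => f (r s) * s).

Lemma scalar_eval_unit s : scalar_eval (fcomb_unit s) = s.
Proof. exact: (@restrict_unit R S f (ring_contra S)). Qed.

Lemma scalar_family (r : fcomb R S) : zero_family (fun s => f (r s) * s).
Proof. exact: zero_familyMr (zero_family_morph f (fcoefP r)). Qed.

Lemma scalar_evalD r r' : scalar_eval (r + r') = scalar_eval r + scalar_eval r'.
Proof.
rewrite /scalar_eval -isumD; try exact: scalar_family.
by congr isum; apply/funext => s; rewrite rmorphD mulrDl.
Qed.

Lemma scalar_evalZ a r : scalar_eval (a *: r) = f a * scalar_eval r.
Proof.
rewrite /scalar_eval -isumMl; last exact: scalar_family.
by congr isum; apply/funext => s; rewrite rmorphM mulrA.
Qed.

Lemma scalar_eval0 : scalar_eval 0 = 0.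
Proof. by apply: (addrI (scalar_eval 0)); rewrite -scalar_evalD !addr0. Qed.

Lemma scalar_evalN r : scalar_eval (- r) = - scalar_eval r.
Proof. by apply: (addrI (scalar_eval r)); rewrite -scalar_evalD !subrr scalar_eval0. Qed.

Lemma scalar_evalB r r' : scalar_eval (r - r') = scalar_eval r - scalar_eval r'.
Proof. by rewrite scalar_evalD scalar_evalN. Qed.

Lemma scalar_eval_bind X (k : X -> fcomb R S) (r : fcomb R X) :
  scalar_eval (fcomb_bind k r) = isum (fun x => f (r x) * scalar_eval (k x)).
Proof.
transitivity (ring_contra_act (fcomb_scalars f (fcomb_bind k r))); first by [].
by rewrite fcomb_scalars_bind ring_contra_bind.
Qed.

(** The kernel is a type so that it can index formal combinations. *)
Definition relation : Type := {r : fcomb R S | scalar_eval r = 0}.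

Definition relation_comb (c : fcomb R relation) : fcomb R S := fcomb_bind sval c.

Lemma relation_combD c c' :
  relation_comb (c + c') = relation_comb c + relation_comb c'.
Proof. exact: fcomb_bindD. Qed.

Lemma relation_combZ a c : relation_comb (a *: c) = a *: relation_comb c.
Proof. exact: fcomb_bindZ. Qed.

Lemma relation_combN c : relation_comb (- c) = - relation_comb c.
Proof. by rewrite -scaleN1r relation_combZ scaleN1r. Qed.

Lemma relation_comb0 : relation_comb 0 = 0.
Proof. by rewrite -(scale0r 0) relation_combZ scale0r. Qed.

Lemma relation_comb_unit k : relation_comb (fcomb_unit k) = sval k.
Proof. exact: fcomb_bind_unit. Qed.

Lemma scalar_eval_relation c : scalar_eval (relation_comb c) = 0.
Proof.
rewrite scalar_eval_bind.
have -> : (fun k : relation => f (c k) * scalar_eval (sval k)) = fun=> 0.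
  by apply/funext => k; rewrite (svalP k) mulr0.
exact: isum0.
Qed.

(** * Purity of the relations modulo an open ideal, from flatness *)

Section Purity.
Variables (A B : two_sided_ideal R) (C : two_sided_ideal S).
Hypothesis BA : forall x, subgroup_set B x -> subgroup_set A x.
Hypothesis B_open : open (subgroup_set B).
Hypothesis C_open : open (subgroup_set C).
Hypothesis fBC : forall x, subgroup_set B x -> subgroup_set C (f x).
Hypothesis C_lift : forall s, subgroup_set C s ->
  exists2 r, fcomb_in B r & scalar_eval r = s.
Hypothesis flat : flat_left_module (quotient_module fBC).

Let pure (k : fcomb R S) : Prop :=
  exists2 c : fcomb R relation, fcomb_in A c & fcomb_in B (k - relation_comb c).

Let pure_in k : fcomb_in B k -> pure k.
Proof. by exists 0; [exact: fcomb_in0|rewrite relation_comb0 subr0]. Qed.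

Let pureD k k' : pure k -> pure k' -> pure (k + k').
Proof.
move=> [c cA kc] [c' c'A kc']; exists (c + c'); first exact: fcomb_inD.
by rewrite relation_combD opprD addrACA; exact: fcomb_inD.
Qed.

Let pureN k : pure k -> pure (- k).
Proof.
move=> [c cA kc]; exists (- c); first exact: fcomb_inN.
by rewrite relation_combN -opprD; exact: fcomb_inN.
Qed.

Let pureB k k' : pure k -> pure k' -> pure (k - k').
Proof. by move=> pk /pureN; exact: pureD. Qed.

Let pure_sum (T : eqType) (s : seq T) (F : T -> fcomb R S) :
  (forall x, x \in s -> pure (F x)) -> pure (\sum_(x <- s) F x).
Proof.
by move=> pF; rewrite big_seq; apply: big_ind => //; exact/pure_in/fcomb_in0.
Qed.

(** The value of [k] is also that of some [r] with coefficients in [B]. Hence [k - r] is a relation,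
    and [a k = a (k - r) + a r] has the required form. *)
Let pureZ a k : subgroup_set A a -> subgroup_set C (scalar_eval k) -> pure (a *: k).
Proof.
move=> Aa /C_lift[r rB rk].
have kr0 : scalar_eval (k - r) = 0 by rewrite scalar_evalB rk subrr.
exists (a *: fcomb_unit (exist _ (k - r) kr0 : relation)); first exact: fcomb_inZ.
rewrite relation_combZ relation_comb_unit /= -scalerBr opprB addrC subrK.
exact: fcomb_inZr.
Qed.

Let M := quotient_module fBC.

Let lift (x : quotient_ideal BA * M) : fcomb R S :=
  quotient_repr (val x.1 : quotient_ring B) *:
    fcomb_unit (quotient_repr (x.2 : quotient_ring C)).

Let lifts (l : seq (quotient_ideal BA * M)) : fcomb R S := \sum_(x <- l) lift x.

Let repr_in (n : quotient_ideal BA) :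
  subgroup_set A (quotient_repr (val n : quotient_ring B)).
Proof. by have /asboolP := quotient_idealP n. Qed.

(* Induction on tensor_rel shows that n (x) m |-> n [m] is well defined modulo pure. *)
Let lifts_rel l l' : tensor_rel l l' -> pure (lifts l - lifts l').
Proof.
elim => {l l'} [l|l l' _|l l' k _ ll' _ l'k|l l' k k' _ ll' _ kk'|l l'
  |n n' m|n m m'|m|n|a n m].
- by rewrite subrr; exact/pure_in/fcomb_in0.
- by move=> /pureN; rewrite opprB.
- by rewrite -(subrK (lifts l') (lifts l)) -addrA; exact: pureD.
- by rewrite /lifts !big_cat /= opprD addrACA; exact: pureD.
- by rewrite /lifts !big_cat /= addrC subrr; exact/pure_in/fcomb_in0.
- rewrite /lifts !big_cons !big_nil !addr0 /lift /= -scalerDl -scalerBl.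
  apply/pure_in/fcomb_inZ/quotient_repr_eq.
  rewrite [RHS]quotient_projD.
  by congr (_ + _); rewrite -[LHS]quotient_reprK.
- rewrite /lifts !big_cons !big_nil !addr0 /lift /= -scalerDr -scalerBr.
  apply: pureZ; first exact: repr_in.
  rewrite scalar_evalB scalar_evalD !scalar_eval_unit; apply: quotient_repr_eq.
  rewrite [RHS]quotient_projD.
  by congr (_ + _); rewrite -[LHS]quotient_reprK.
- rewrite /lifts !big_cons !big_nil addr0 subr0; apply/pure_in/fcomb_inZ.
  rewrite -[quotient_repr _]subr0; apply: quotient_repr_eq.
  by rewrite [LHS](raddf0 val) quotient_ring_proj0.
- rewrite /lifts !big_cons !big_nil addr0 subr0; apply: pureZ; first exact: repr_in.
  rewrite scalar_eval_unit -[quotient_repr _]subr0; apply: quotient_repr_eq.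
  by rewrite quotient_ring_proj0.
- have [b ->] := quotient_ring_proj_surj a.
  rewrite /lifts !big_cons !big_nil !addr0 /lift /=.
  set x := quotient_repr (val (_ *: n)); set y := quotient_repr (val n).
  set u := fcomb_unit (quotient_repr m); set v := fcomb_unit _.
  (* The first coefficient lies in [B]; in the second term [y] lies in [A] and the bracket has value
     in [C], so [pureZ] applies. *)
  have -> : x *: u - y *: v = (x - y * b) *: u + y *: (b *: u - v).
    by rewrite scalerBl scalerBr scalerA addrA subrK.
  apply: pureD.
    apply/pure_in/fcomb_inZ/quotient_repr_eq; rewrite [LHS](linearZ_LR val).
    rewrite -quotient_ring_mulE; congr (quotient_ring_mul _ _).
    by rewrite quotient_reprK.
  apply: pureZ; first exact: repr_in.
  rewrite scalar_evalB scalar_evalZ !scalar_eval_unit -opprB.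
  apply/subgroupN/quotient_repr_eq; rewrite [LHS]quotient_module_scaleE -quotient_ring_mulE.
  by congr (quotient_ring_mul _ _); rewrite quotient_reprK.
Qed.

(** This is the isomorphism of the tensor product of [R/B] and [M] with [M], read on
    representatives. *)
Lemma tensor_collapse (T : Type) (s : seq T) (c : T -> quotient_ring B) (q : T -> M) :
  @tensor_rel (quotient_ring B) (quotient_ring B)^c^o M [seq (c i, q i) | i <- s]
    [:: (1, \sum_(i <- s) c i *: q i)].
Proof.
elim: s => [|i s IH] /=.
  by rewrite big_nil; apply/tensor_sym/tensor_zeror.
rewrite big_cons; apply: tensor_trans (tensor_sym (tensor_addr _ _ _)).
rewrite -cat1s -[in X in tensor_rel _ X]cat1s; apply: tensor_cat => //.
apply: tensor_trans (tensor_balanced _ _ _).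
suff -> : (c i : (quotient_ring B)^c) *: (1 : (quotient_ring B)^c^o) = c i.
  exact: tensor_refl.
exact: mul1r (c i).
Qed.

(** The finite part of [k] modulo [B] defines a tensor over [R/B] in [A/B] and [S/C]. Its image in
    [S/C] is the class of the value of [k], which is zero, so by flatness the tensor vanishes and
    [lifts_rel] applies. *)
Lemma relation_pure k : scalar_eval k = 0 -> fcomb_in A k -> pure k.
Proof.
move=> k0 kA; have [t ut tB] := zero_family_seq B_open (fcoefP k).
have cA s :
    (quotient_ring_proj B (k s) : (quotient_ring B)^c^o) \in quotient_ideal_pred BA.
  exact/(quotient_ideal_predE BA).
pose c s : quotient_ideal BA := QuotientIdeal (cA s).
pose l := [seq (c s, quotient_ring_proj C s : M) | s <- t].
have l0 : tensor_rel l [::].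
  apply/tensor_classP/(flat (g := val)).
    exact: val_inj.
  rewrite !tensor_mapE; apply/tensor_classP; rewrite -map_comp.
  apply: tensor_trans (tensor_collapse _ _ _) _.
  suff -> : \sum_(s <- t) (quotient_ring_proj B (k s) : quotient_ring B) *:
      (quotient_ring_proj C s : M) = 0 by exact: tensor_zeror.
  have -> : \sum_(s <- t) (quotient_ring_proj B (k s) : quotient_ring B) *:
      (quotient_ring_proj C s : M) = quotient_ring_proj C (\sum_(s <- t) f (k s) * s).
    elim: (t) => [|s t' IH]; first by rewrite !big_nil quotient_ring_proj0.
    rewrite !big_cons IH [RHS]quotient_projD; congr (_ + _).
    by rewrite [LHS]quotient_module_scaleE; exact: quotient_ring_mulE.
  rewrite -(quotient_ring_proj0 C); apply/quotient_projP; rewrite subr0.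
  have fB s : (s : {classic S}) \notin t -> subgroup_set C (f (k s) * s).
    by move=> /tB/fBC; exact: ideal_mulr.
  have := isum_mod C_open (scalar_family k) ut fB.
  by rewrite -/(scalar_eval k) k0 sub0r => /subgroupN; rewrite opprK.
have := lifts_rel l0; rewrite /lifts big_nil subr0 big_map => pl.
(* It remains to compare [k] with the lift of the tensor: first cut [k] down to its support modulo
   [B], then change the representatives of coefficients and of elements of [S]. *)
pose k' := \sum_(s <- t) k s *: fcomb_unit s.
have kk' : fcomb_in B (k - k').
  move=> s; rewrite /k' /GRing.add/= /fcomb_opp/= mulN1r fcomb_sumE.
  have kE i : (k i *: fcomb_unit i : fcomb R S) s = if `[< i = s >] then k s else 0.
    transitivity (k i * (if `[< i = s >] then 1 else 0)); first by [].
    by case: asboolP => [->|_]; rewrite ?mulr1 ?mulr0.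
  under eq_bigr do rewrite kE.
  have [st|st] := boolP ((s : {classic S}) \in t).
    rewrite (bigD1_seq (I := {classic S}) s st ut) /= asboolT// big1 ?addr0 ?subrr.
      exact: subgroup0.
    by move=> i /eqP is_; rewrite asboolF.
  rewrite big1_seq ?subr0; first exact: tB.
  by move=> i /= it; rewrite asboolF// => is_; rewrite -is_ it in st.
rewrite -(subrK k' k); apply: pureD; first exact: pure_in.
rewrite -(subrK (\sum_(s <- t) lift (c s, quotient_ring_proj C s : M)) k').
apply: pureD => //; rewrite -sumrB; apply: pure_sum => s _.
rewrite /lift /=; set a := quotient_repr _; set u := fcomb_unit (quotient_repr _).
have -> : k s *: fcomb_unit s - a *: u = k s *: (fcomb_unit s - u) - (a - k s) *: u.
  by rewrite scalerBr scalerBl opprB addrA subrK.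
apply: pureB; last exact/pure_in/fcomb_inZ/quotient_repr_eq.
apply: pureZ; first exact: kA.
by rewrite scalar_evalB !scalar_eval_unit -opprB; apply/subgroupN/quotient_repr_eq.
Qed.

End Purity.
End ScalarEval.

(** * Free contramodules, and morphisms determined by generators *)

Section FreeContramodule.
Variable R : completeLinearRingType.

Fact free_contra_assoc X (r : fcomb R (fcomb R (fcomb R X))) :
  fcomb_join (fcomb_map (@fcomb_join R X) r) = fcomb_join (fcomb_join r).
Proof. by rewrite !fcomb_joinE fcomb_bind_map fcomb_bind_bind. Qed.

Definition free_contra X : contramodule R :=
  Contramodule (ContraStructure (@fcomb_join_unit R X) (@free_contra_assoc X)).

Lemma fcomb_map0 X Y (g : X -> Y) : fcomb_map g (0 : fcomb R X) = 0.
Proof. by rewrite fcomb_mapE -(scale0r (0 : fcomb R X)) fcomb_bindZ scale0r. Qed.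

Section Generators.
Variables (M P : contramodule R) (Y : Type) (g : Y -> M).
Hypothesis g_gen : forall m, exists r, cact (fcomb_map g r) = m.

Lemma contra_hom_ext (H H' : contra_hom M P) :
  (forall y, H (g y) = H' (g y)) -> forall m, H m = H' m.
Proof.
move=> HH' m; have [r <-] := g_gen m; rewrite !contra_homP !fcomb_map_comp.
by congr (cact (fcomb_map _ r)); apply/funext.
Qed.

(** [M] is the quotient of the free contramodule on [Y] by the kernel of evaluation at [g], and the
    map induced by [h] kills that kernel. *)
Lemma contra_hom_factor (h : Y -> P) :
  (forall r, cact (fcomb_map g r) = 0 -> cact (fcomb_map h r) = 0) ->
  exists H : contra_hom M P, forall y, H (g y) = h y.
Proof.
move=> ker.
have wd r r' : cact (fcomb_map g r) = cact (fcomb_map g r') ->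
    cact (fcomb_map h r) = cact (fcomb_map h r').
  have cactB Z (k : Z -> P) s s' :
      cact (fcomb_map k (s - s')) = cact (fcomb_map k s) - cact (fcomb_map k s').
    rewrite !fcomb_mapE fcomb_bindD cactD -scaleN1r fcomb_bindZ cactZ.
    by rewrite scaleN1r.
  move=> /eqP; rewrite -subr_eq0 => /eqP e; apply/eqP; rewrite -subr_eq0 -cactB.
  apply/eqP/ker; rewrite -[RHS]e !fcomb_mapE fcomb_bindD cactD -scaleN1r.
  by rewrite fcomb_bindZ cactZ scaleN1r.
have [c cP] := choice g_gen.
(* The chosen preimages [c m] need not be compatible with the structure, but by [wd] only their
   values under [g] matter. *)
have HP : is_contra_hom (fun m => cact (fcomb_map h (c m))).
  move=> r; rewrite -cact_bind -fcomb_map_bind; apply: wd.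
  rewrite cP fcomb_map_bind cact_bind; congr cact.
  by rewrite -[LHS]fcomb_map_id; congr (fcomb_map _ r); apply/funext => m /=.
exists (ContraHom HP) => y /=.
rewrite (wd _ (fcomb_unit y)); first by rewrite fcomb_map_unit cact_unit.
by rewrite cP fcomb_map_unit cact_unit.
Qed.

End Generators.
End FreeContramodule.

(** * The restriction of [S[[X]]] to [R] *)

Section RestrictFree.
Variables (R S : completeLinearRingType) (f : continuousRMorphism R S) (X : Type).

Let F := restrict f (free_contra S X).

(** The addition of [F] is derived from its [R]-contramodule structure, so its agreement with
    coefficientwise addition needs an argument. *)
Lemma restrict_free_addE (p q : fcomb S X) : (p : F) + (q : F) = p + q.
Proof.
rewrite [LHS]/GRing.add/= /contra_add [LHS]/cact /= /restrict_act.
transitivity (fcomb_bind id (fcomb_scalars f (fcomb_unit (p : F) + fcomb_unit (q : F)))).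
  by [].
have -> : fcomb_scalars f (fcomb_unit (p : F) + fcomb_unit (q : F)) =
    fcomb_unit p + fcomb_unit q.
  rewrite -[fcomb_unit p](fcomb_scalars_unit f) -[fcomb_unit q](fcomb_scalars_unit f).
  by apply: fcomb_eq => x; rewrite /= rmorphD.
by rewrite fcomb_bindD !fcomb_bind_unit.
Qed.

Lemma restrict_free_zeroE : (0 : F) = (0 : fcomb S X).
Proof.
by apply: (addrI ((0 : F) : fcomb S X)); rewrite addr0 -restrict_free_addE addr0.
Qed.

Definition free_gen (p : X * S) : F := p.2 *: (fcomb_unit p.1 : fcomb S X).

Definition comb_row (r : fcomb R (X * S)) (x : X) : fcomb R S :=
  FComb (zero_family2_in (zero_family_curry (fcoefP r)) x).

(** This reduces questions about generators of [S[[X]]] and relations between them to [scalar_eval],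
    one row at a time. *)
Lemma free_gen_combE (r : fcomb R (X * S)) x :
  (cact (fcomb_map free_gen r) : fcomb S X) x = scalar_eval f (comb_row r x).
Proof.
have -> : cact (fcomb_map free_gen r) = fcomb_bind free_gen (fcomb_scalars f r).
  transitivity (fcomb_bind id (fcomb_scalars f (fcomb_map free_gen r))); first by [].
  by rewrite fcomb_scalars_map fcomb_bind_map.
pose c x' s := f (r (x', s)) * (s * (if `[< x' = x >] then 1 else 0)).
transitivity (isum (fun p : X * S => c p.1 p.2)).
  by congr isum; apply/funext => -[].
rewrite isum_pair.
  rewrite (@isum_single _ _ _ x) => [|x' x'x].
    by congr isum; apply/funext => s; rewrite /c asboolT// mulr1.
  have -> : c x' = fun=> 0 by apply/funext => s; rewrite /c asboolF// !mulr0.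
  exact: isum0.
have r0 := zero_familyMr (fun p : X * S => p.2 * (if `[< p.1 = x >] then 1 else 0))
  (zero_family_morph f (fcoefP r)).
exact: zero_family_curry r0.
Qed.

End RestrictFree.

(** * Lifting values and relations with control of the coefficients *)

Section Lifting.
Variables (R S : completeLinearRingType) (f : continuousRMorphism R S).
Variables (I : nat -> two_sided_ideal R) (J : nat -> two_sided_ideal S).
Hypothesis I_open : forall n, open (subgroup_set (I n)).
Hypothesis J_open : forall n, open (subgroup_set (J n)).
Hypothesis JE :
  forall n, subgroup_set (J n) = extended_ideal_closure f (subgroup_set (I n)).
Hypothesis I_whole : forall x, subgroup_set (I 0%N) x.
Hypothesis I_decS : forall n x, subgroup_set (I n.+1) x -> subgroup_set (I n) x.
Hypothesis I_base : forall V : set R, nbhs 0 V ->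
  exists n, subset (subgroup_set (I n)) V.

Let I_dec m n : (m <= n)%N -> forall x,
  subgroup_set (I n) x -> subgroup_set (I m) x.
Proof.
move=> /subnK <-; elim: (n - m)%N => [//|k IH] x; rewrite addSn => /I_decS; exact: IH.
Qed.

Let I_open_base (K : two_sided_ideal R) : open (subgroup_set K) ->
  exists n, forall m, (n <= m)%N -> forall x, subgroup_set (I m) x -> subgroup_set K x.
Proof.
move=> Ko; have [n nK] := I_base (@open_subgroup_nbhs R (OpenSubgroup Ko)).
by exists n => m nm x /(I_dec nm)/nK.
Qed.

Let IJ n x : subgroup_set (I n) x -> subgroup_set (J n) (f x).
Proof. exact: (extended_ideal_closure_sub (JE n)). Qed.

Let J_whole x : subgroup_set (J 0%N) x.
Proof. by rewrite JE -[x]mul1r -(rmorph1 f); exact/gen_in_closure/I_whole. Qed.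

Let J_dec m n : (m <= n)%N -> forall x,
  subgroup_set (J n) x -> subgroup_set (J m) x.
Proof.
move=> mn x; rewrite JE; apply: extended_closure_sub => // a /(I_dec mn); exact: IJ.
Qed.

(** By continuity some [f(I n)] lies in [K], and [K] is closed, so it contains [J n]. *)
Let J_base (K : two_sided_ideal S) : open (subgroup_set K) ->
  exists n, forall x, subgroup_set (J n) x -> subgroup_set K x.
Proof.
move=> Ko.
have fc : continuous f by exact: cts_fun.
have : nbhs (0 : R) (f @^-1` subgroup_set K)%classic.
  apply: (fc 0); rewrite rmorph0.
  exact: (@open_subgroup_nbhs S (OpenSubgroup Ko)).
move=> /I_base[n nK]; exists n => x; rewrite JE.
by apply: extended_closure_sub => // a /nK.
Qed.

Let J_sep x : (forall n, subgroup_set (J n) x) -> x = 0.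
Proof.
move=> xJ; apply: eq_mod_open => K /J_base[n nK]; rewrite subr0; exact/nK/xJ.
Qed.

Lemma scalar_eval_in n r : fcomb_in (I n) r -> subgroup_set (J n) (scalar_eval f r).
Proof.
move=> rI; apply: isum_in => // [|s]; first exact: scalar_family.
exact/ideal_mulr/IJ.
Qed.

Lemma scalar_eval_step n s : subgroup_set (J n) s ->
  exists2 r, fcomb_in (I n) r & subgroup_set (J n.+1) (s - scalar_eval f r).
Proof.
have J0 := @open_subgroup_nbhs S (OpenSubgroup (J_open n.+1)).
rewrite [X in X s]JE => /(_ _ (nbhs_shift s J0)) [z [/= zI zJ]].
suff [r rI rz] : exists2 r, fcomb_in (I n) r & scalar_eval f r = z.
  by exists r; rewrite // rz -opprB; exact: subgroupN.
(* The values of combinations with coefficients in [I n] form a right ideal containing [f(I n)],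
   hence contain [z]. *)
apply: (zI (fun z => exists2 r, fcomb_in (I n) r & scalar_eval f r = z)).
split; last first.
  move=> _ [a Ia <-]; exists (a *: fcomb_unit 1); first exact: fcomb_inZ.
  by rewrite scalar_evalZ scalar_eval_unit mulr1.
split.
- by exists 0; [exact: fcomb_in0|exact: scalar_eval0].
- move=> _ _ [r rI <-] [r' rI' <-]; exists (r - r'); first exact: fcomb_inB.
  exact: scalar_evalB.
- move=> a _ [r rI <-].
  (* Right multiplication by [a] moves the coefficient at [s] to [s * a]. *)
  exists (fcomb_bind (fun s => fcomb_unit (s * a)) r); first exact: fcomb_in_bind.
  rewrite scalar_eval_bind -isumMr; last exact: scalar_family.
  by congr isum; apply/funext => x; rewrite scalar_eval_unit mulrA.
Qed.

Lemma scalar_eval_lift s : exists2 r, scalar_eval f r = s &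
  forall n, subgroup_set (J n) s -> fcomb_in (I n) r.
Proof.
apply: (approx I_open I_open_base I_dec (@scalar_evalD _ _ f) J_sep J_dec) => //.
- exact: scalar_eval_in.
- exact: scalar_eval_step.
Qed.

Hypothesis flat : forall n,
  flat_left_module (quotient_module (extended_ideal_closure_sub (JE n))).

Fact relation_subgroup_subproof n (k k' : fcomb R S) :
  scalar_eval f k = 0 /\ fcomb_in (I n) k -> scalar_eval f k' = 0 /\ fcomb_in (I n) k' ->
  scalar_eval f (k - k') = 0 /\ fcomb_in (I n) (k - k').
Proof.
move=> [k0 kI] [k'0 k'I]; split; first by rewrite scalar_evalB k0 k'0 subr0.
exact: fcomb_inB.
Qed.

Definition relation_subgroup n : subgroup (fcomb R S) :=
  @Subgroup (fcomb R S) (fun k => scalar_eval f k = 0 /\ fcomb_in (I n) k)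
    (conj (scalar_eval0 f) (fcomb_in0 (I n) (X := S))) (@relation_subgroup_subproof n).

(** Successive approximation again, now for [relation_comb] and the filtration of the kernel by
    [relation_subgroup]; each step is [relation_pure] for [I n.+1] inside [I n]. *)
Lemma relation_lift k : scalar_eval f k = 0 ->
  exists2 c : fcomb R (relation f), relation_comb c = k &
    forall n, fcomb_in (I n) k -> fcomb_in (I n) c.
Proof.
move=> k0.
have sep x : (forall n, subgroup_set (relation_subgroup n) x) -> x = 0.
  move=> xI; apply: fcomb_eq0_mod => K /I_open_base[n nK] s.
  exact/(nK n)/(xI n).2.
have dec m n : (m <= n)%N -> forall x, subgroup_set (relation_subgroup n) x ->
    subgroup_set (relation_subgroup m) x.
  by move=> mn x [x0 xI]; split=> // s; exact/(I_dec mn)/xI.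
have comb n (c : fcomb R (relation f)) : fcomb_in (I n) c ->
    subgroup_set (relation_subgroup n) (relation_comb c).
  move=> cI; split; last exact: (@fcomb_in_bind R (I n) _ _ sval c (I_open n) cI).
  exact: scalar_eval_relation.
have step n x : subgroup_set (relation_subgroup n) x -> 
    exists2 c : fcomb R (relation f), fcomb_in (I n) c &
      subgroup_set (relation_subgroup n.+1) (x - relation_comb c).
  move=> [x0 xI].
  have lift s : subgroup_set (J n.+1) s ->
      exists2 r, fcomb_in (I n.+1) r & scalar_eval f r = s.
    by have [r rs rI] := scalar_eval_lift s; exists r; auto.
  have [c cI cx] := relation_pure (@I_decS n) (I_open n.+1) (J_open n.+1) lift
    (flat (n := n.+1)) x0 xI.
  exists c => //; split=> //.
  by rewrite scalar_evalB x0 scalar_eval_relation subr0.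
have k1 : subgroup_set (relation_subgroup 0%N) k by split=> // s; exact: I_whole.
have [c ck cI] :=
  approx I_open I_open_base I_dec (@relation_combD R S f) sep dec comb step k1.
by exists c => // n kI; exact: cI.
Qed.

Variable X : Type.

Let zero_family2_I T (c : X -> fcomb R T) :
  (forall n, exists t : seq {classic X},
    forall x, (x : {classic X}) \notin t -> fcomb_in (I n) (c x)) ->
  zero_family2 (fun x y => c x y).
Proof.
move=> cI; apply: zero_family2_by_rows => [K /I_open_base[n nK]|x]; last exact: fcoefP.
by have [t tI] := cI n; exists t => x y /tI xI; exact/(nK n)/xI.
Qed.

(** Each coefficient is lifted separately; the control in [scalar_eval_lift] makes the lifts
    converge to zero along [X], so they assemble into one combination. *)
Lemma free_gen_surj (r : restrict f (free_contra S X)) :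
  exists c, cact (fcomb_map (@free_gen R S f X) c) = r.
Proof.
have lift x : exists c, scalar_eval f c = (r : fcomb S X) x /\
    forall n, subgroup_set (J n) ((r : fcomb S X) x) -> fcomb_in (I n) c.
  by have [c] := scalar_eval_lift ((r : fcomb S X) x); exists c.
have [c cP] := choice lift.
have c0 : zero_family2 (fun x y => c x y).
  apply: zero_family2_I => n.
  have [t _ tJ] := zero_family_seq (J_open n) (fcoefP (r : fcomb S X)).
  by exists t => x /tJ; exact: (cP x).2.
exists (FComb (zero_family_pair c0)); apply: fcomb_eq => x.
rewrite free_gen_combE -(cP x).1; congr scalar_eval; exact: fcomb_eq.
Qed.

Lemma fcomb_map_pair (x x' : X) (k : fcomb R S) s :
  fcomb_map (pair x') k (x, s) = if `[< x' = x >] then k s else 0.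
Proof.
rewrite fcomb_mapE /= -/(isum _) (@isum_single _ _ _ s).
  have [->|x'x] := asboolP (x' = x); first by rewrite asboolT ?mulr1.
  by rewrite asboolF ?mulr0// => -[].
by move=> s' s's; rewrite asboolF ?mulr0// => -[_ /s's].
Qed.

(** Every row of [r] is a relation, and the controlled lifts of the rows form a zero-convergent
    family. *)
Lemma free_gen_ker (P : contramodule R) (h : X -> coext f P) (r : fcomb R (X * S)) :
  cact (fcomb_map (@free_gen R S f X) r) = 0 ->
  cact (fcomb_map (fun p => h p.1 p.2) r) = 0.
Proof.
move=> r0.
have lift x : exists c : fcomb R (relation f), relation_comb c = comb_row r x /\
    forall n, fcomb_in (I n) (comb_row r x) -> fcomb_in (I n) c.
  have [|c] := @relation_lift (comb_row r x); last by exists c.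
  by rewrite -free_gen_combE r0 restrict_free_zeroE.
have [c cP] := choice lift.
have c0 : zero_family2 (fun x y => c x y).
  apply: zero_family2_I => n.
  have [t [u tu]] := zero_family_curry (fcoefP r) (I_open n).
  by exists t => x xt; apply: (cP x).2 => s; apply: tu; left.
pose k (p : X * relation f) := fcomb_map (pair p.1) (sval p.2).
(* [k (x, y)] is the relation [y] placed in row [x], so [r] becomes one combination of single
   relations. *)
have -> : r = fcomb_bind k (FComb (zero_family_pair c0)).
  apply: fcomb_eq => -[x s].
  pose d x' (y : relation f) := c x' y * (if `[< x' = x >] then sval y s else 0).
  transitivity (isum (fun p : X * relation f => d p.1 p.2)); last first.
    by congr isum; apply/funext => -[x' y]; rewrite /d -fcomb_map_pair.
  rewrite isum_pair; last first.
    move=> K /c0[t [u tu]]; exists t, u => x' y /tu; exact: ideal_mulr.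
  rewrite (@isum_single _ _ _ x) => [|x' x'x].
    transitivity (comb_row r x s); first by [].
    rewrite -(cP x).1; congr isum.
    by apply/funext => y; rewrite /d asboolT.
  have -> : d x' = fun=> 0 by apply/funext => y; rewrite /d asboolF// mulr0.
  exact: isum0.
(* By associativity it suffices that each single relation acts as zero, which holds because [h x] is
   a morphism on [S]. *)
rewrite fcomb_map_bind cact_bind -[RHS](cact_map_const0 _ (FComb (zero_family_pair c0))).
congr (cact (fcomb_map _ _)); apply/funext => -[x y].
rewrite /k fcomb_map_comp.
transitivity (cact (fcomb_map (h x) (sval y))); first by [].
rewrite -contra_homP; transitivity (h x (scalar_eval f (sval y))); first by [].
by rewrite (svalP y) -(scalar_eval0 f) [LHS](contra_homP (h x)) fcomb_map0.
Qed.

End Lifting.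

(** This is the universal property of [S[[X]]] as the coproduct of [X] copies of [S] among
    [R]-contramodules, and all that the sequel takes from proflatness. *)
Lemma proflat_free_universal (R S : completeLinearRingType)
    (f : continuousRMorphism R S) :
  countable_zero_base R -> left_proflat f -> forall (X : Type) (P : contramodule R),
  (forall H H' : contra_hom (restrict f (free_contra S X)) P,
    (forall x s, H (free_gen f (x, s)) = H' (free_gen f (x, s))) ->
    forall r, H r = H' r) /\
  forall h : X -> coext f P, exists H : contra_hom (restrict f (free_contra S X)) P,
    forall x s, H (free_gen f (x, s)) = h x s.
Proof.
move=> Rc [taut flat] X P.
have [I [J [[Io Jo] JE I0 Idec Ibase]]] := taut_sequence Rc taut.
have flatn n := flat (I n) (J n) (JE n) (Io n) (Jo n).
have surj := free_gen_surj Io Jo JE I0 Idec Ibase (X := X).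
split=> [H H' HH' r|h].
  by apply: (contra_hom_ext surj) => -[x s]; exact: HH'.
have [H HE] := contra_hom_factor surj
  (free_gen_ker Io Jo I0 Idec Ibase flatn h).
by exists H => x s; rewrite HE.
Qed.

(** * Scalar multiplication and morphisms of contramodules *)

Section ScalarActions.
Variable S : completeLinearRingType.

Lemma free_scaleE X a (r : fcomb S X) : a *: (r : free_contra S X) = a *: r.
Proof.
transitivity (fcomb_join (a *: fcomb_unit r)); first by [].
by rewrite fcomb_joinE fcomb_bindZ fcomb_bind_unit.
Qed.

Fact orbit_subproof (Q : contramodule S) (q : Q) :
  @is_contra_hom S (ring_contra S) Q (fun s => s *: q).
Proof.
move=> r; pose k (s : S) := s *: fcomb_unit (R := S) q.
transitivity (cact (fcomb_bind k r)); last exact: cact_bind.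
transitivity (cact (ring_contra_act r *: fcomb_unit q)); first by [].
congr cact; apply: fcomb_eq => x.
transitivity (ring_contra_act r * fcomb_unit q x); first by [].
rewrite /ring_contra_act -/(isum _) -isumMr; last exact: zero_familyMr (fcoefP r).
by congr isum; apply/funext => s; rewrite -mulrA.
Qed.

Definition orbit (Q : contramodule S) (q : Q) : contra_hom (ring_contra S) Q :=
  ContraHom (orbit_subproof q).

Fact free_map_subproof X Y (g : X -> Y) :
  @is_contra_hom S (free_contra S X) (free_contra S Y) (fcomb_map g).
Proof.
move=> r; transitivity (fcomb_join (fcomb_map (fcomb_map g) r)); last by [].
by rewrite [LHS]fcomb_map_bind fcomb_joinE fcomb_bind_map.
Qed.

Definition free_map X Y (g : X -> Y) : contra_hom (free_contra S X) (free_contra S Y) :=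
  ContraHom (free_map_subproof g).

Fact free_eval_subproof (Q : contramodule S) :
  @is_contra_hom S (free_contra S Q) Q (@cact S Q).
Proof. by move=> r; rewrite -[RHS]cact_bind. Qed.

Definition free_eval (Q : contramodule S) : contra_hom (free_contra S Q) Q :=
  ContraHom (@free_eval_subproof Q).

Lemma fcomb_mapZ X Y (g : X -> Y) a (r : fcomb S X) :
  fcomb_map g (a *: r) = a *: fcomb_map g r.
Proof. by rewrite !fcomb_mapE fcomb_bindZ. Qed.

Lemma contra_homZ (Q Q' : contramodule S) (h : contra_hom Q Q') a q :
  h (a *: q) = a *: h q.
Proof. by rewrite [LHS](contra_homP h) fcomb_mapZ fcomb_map_unit. Qed.

End ScalarActions.

(** * The contramodule structure on [Hom(S, P)] and the adjunction *)

Section Coinduction.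
Variables (R S : completeLinearRingType) (f : continuousRMorphism R S).
Hypothesis universal : forall (X : Type) (P : contramodule R),
  (forall H H' : contra_hom (restrict f (free_contra S X)) P,
    (forall x s, H (free_gen f (x, s)) = H' (free_gen f (x, s))) ->
    forall r, H r = H' r) /\
  forall h : X -> coext f P, exists H : contra_hom (restrict f (free_contra S X)) P,
    forall x s, H (free_gen f (x, s)) = h x s.

(** The extension of the tautological family, indexed by [Hom(S, P)] itself. *)
Definition coext_sum (P : contramodule R) :
    contra_hom (restrict f (free_contra S (coext f P))) P :=
  sval (cid ((universal (coext f P) P).2 id)).

Lemma coext_sum_gen P (h : coext f P) s :
  coext_sum P (s *: (fcomb_unit h : fcomb S (coext f P))) = h s.
Proof. exact: (svalP (cid ((universal (coext f P) P).2 id))). Qed.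

(** The future adjunct of [g], namely [q |-> (s |-> g(s q))]. *)
Definition transpose (Q : contramodule S) (P : contramodule R)
    (g : contra_hom (restrict f Q) P) (q : Q) : coext f P :=
  contra_hom_comp g (restrict_hom f (orbit q)).

Definition coext_act P (r : fcomb S (coext f P)) : coext f P :=
  transpose (coext_sum P) (r : free_contra S (coext f P)).

Lemma coext_actE P r s : coext_act (P := P) r s = coext_sum P (s *: r).
Proof. by rewrite -free_scaleE. Qed.

(** At [s], both sides are morphisms [S[[Q]] -> P] evaluated at [s r]; both send a generator [t q]
    to [g(t q)], so uniqueness applies. Associativity, functoriality and the adjunction all rest on
    this identity. *)
Lemma coext_act_transpose (Q : contramodule S) P (g : contra_hom (restrict f Q) P)
  (r : fcomb S Q) : coext_act (fcomb_map (transpose g) r) = transpose g (cact r).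
Proof.
apply: contra_hom_eq => s; rewrite coext_actE -fcomb_mapZ.
transitivity (g (cact (s *: r))); last by rewrite cactZ.
pose H := contra_hom_comp (coext_sum P) (restrict_hom f (free_map S (transpose g))).
pose H' := contra_hom_comp g (restrict_hom f (free_eval Q)).
apply: ((universal Q P).1 H H') => q t /=.
by rewrite fcomb_mapZ fcomb_map_unit coext_sum_gen.
Qed.

Fact coext_act_unit P (h : coext f P) : coext_act (fcomb_unit h) = h.
Proof. by apply: contra_hom_eq => s; rewrite coext_actE coext_sum_gen. Qed.

Fact coext_act_assoc P (r : fcomb S (fcomb S (coext f P))) :
  coext_act (fcomb_map (@coext_act P) r) = coext_act (fcomb_join r).
(* [coext_act] is itself the transpose of [coext_sum P]. *)
Proof. exact: (@coext_act_transpose (free_contra S (coext f P))). Qed.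

Definition coext_structure (P : contramodule R) : contra_structure S (coext f P) :=
  ContraStructure (@coext_act_unit P) (@coext_act_assoc P).

Lemma coext_structure_linear P : linear (@coext_contra_id R S f coext_structure P).
Proof.
move=> a h k; apply: contra_hom_eq => s.
have sumE (r : fcomb S (coext f P)) :
    (cact (r : fcomb S (coext_contra coext_structure P)) : coext f P) s =
    coext_sum P (s *: r).
  exact: coext_actE.
transitivity (coext_sum P (s *: (a *: fcomb_unit h + fcomb_unit k))).
  rewrite -sumE cactD cactZ /coext_contra_id.
  by rewrite [cact (fcomb_unit h)]cact_unit [cact (fcomb_unit k)]cact_unit.
(* [coext_sum] is additive for the addition of the restricted contramodule, so the sum is first read
   there. *)
rewrite scalerDr scalerA -restrict_free_addE contra_homD !coext_sum_gen.
by [].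
Qed.

Lemma coext_structureZ P s (h : coext_contra coext_structure P) t :
  (s *: h : coext f P) t = (h : coext f P) (t * s).
Proof.
transitivity ((coext_act (s *: fcomb_unit h) : coext f P) t); first by [].
by rewrite coext_actE scalerA coext_sum_gen.
Qed.

(** The action of [r] evaluated at 1 is [coext_sum] of [r] with scalars extended. That element is an
    [R]-combination of units in [S[[Hom(S, P)]]], and [coext_sum] sends the unit at [h] to [h 1]. *)
Fact coext_at1_subproof P :
  @is_contra_hom R (restrict f (coext_contra coext_structure P)) P
    (fun h : coext f P => h 1).
Proof.
move=> r.
transitivity (coext_sum P (fcomb_scalars f r)).
  transitivity ((coext_act (fcomb_scalars f r) : coext f P) 1); first by [].
  by rewrite coext_actE scale1r.
have -> : fcomb_scalars f r =
    cact (fcomb_map fcomb_unit r : fcomb R (restrict f (free_contra S (coext f P)))).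
  transitivity (fcomb_join (fcomb_scalars f (fcomb_map fcomb_unit r))); last by [].
  by rewrite fcomb_scalars_map fcomb_joinE fcomb_bind_map fcomb_bind_unitr.
rewrite contra_homP fcomb_map_comp; congr (cact (fcomb_map _ r)).
by apply/funext => h; rewrite -[RHS]coext_sum_gen scale1r.
Qed.

Definition coext_at1 P : contra_hom (restrict f (coext_contra coext_structure P)) P :=
  ContraHom (@coext_at1_subproof P).

Lemma coext_structure_functorial : coext_functorial coext_structure.
Proof.
move=> P P' g r.
(* h |-> h(1) has transpose the identity. *)
have gE : coext_map g = transpose (contra_hom_comp g (coext_at1 P)) :> (_ -> coext f P').
  apply/funext => h; apply: contra_hom_eq => s.
  transitivity (g (h (1 * s))); first by rewrite mul1r.
  by congr (contra_hom_fun g _); rewrite -coext_structureZ.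
by rewrite gE; exact/esym/coext_act_transpose.
Qed.

Fact transpose_contra_hom (Q : contramodule S) P (g : contra_hom (restrict f Q) P) :
  @is_contra_hom S Q (coext_contra coext_structure P) (transpose g).
Proof. by move=> r; exact/esym/coext_act_transpose. Qed.

(** The two directions are [transpose] and evaluation at 1; they are inverse since [g(1 q) = g(q)]
    and [(k(s q))(1) = (k q)(1 s)]. *)
Lemma coext_adjunction : exists a :
    adjunction (restrict_functor f) (coext_functor coext_structure_functorial),
  forall (P : contramodule R) (h : coext f P),
    (counit a P : contra_hom (restrict f (coext_contra coext_structure P)) P) h =
    coext_eval h.
Proof.
pose G := coext_functor coext_structure_functorial.
pose adj (Q : Contra S) (P : Contra R) (g : mor (restrict_functor f Q) P) : mor Q (G P) :=
  ContraHom (transpose_contra_hom g).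
pose adj_inv (Q : Contra S) (P : Contra R) (k : mor Q (G P)) :
  mor (restrict_functor f Q) P := contra_hom_comp (coext_at1 P) (restrict_hom f k).
have adjK Q P : cancel (@adj Q P) (@adj_inv Q P).
  by move=> g; apply: contra_hom_eq => q /=; rewrite scale1r.
have adj_invK Q P : cancel (@adj_inv Q P) (@adj Q P).
  move=> k; apply: contra_hom_eq => q; apply: contra_hom_eq => s.
  transitivity ((k (s *: q) : coext f P) 1); first by [].
  by rewrite contra_homZ [LHS]coext_structureZ mul1r.
have adjl (Q Q' : Contra S) (P : Contra R) (k : mor Q' Q)
    (g : mor (restrict_functor f Q) P) :
    adj _ _ (compm g (fmor (restrict_functor f) k)) = compm (adj _ _ g) k.
  by apply: contra_hom_eq => q; apply: contra_hom_eq => s /=; rewrite contra_homZ.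
have adjr (Q : Contra S) (P P' : Contra R) (h : mor P P')
    (g : mor (restrict_functor f Q) P) :
    adj _ _ (compm h g) = compm (fmor G h) (adj _ _ g).
  by apply: contra_hom_eq => q; exact: contra_hom_eq.
exists (Adjunction adjK adj_invK adjl adjr) => P h.
(* The counit is [h |-> h 1], while [coext_eval] gives [h (f 1)]. *)
by rewrite /coext_eval/= rmorph1.
Qed.

End Coinduction.

Theorem theorem10p4 (R S : completeLinearRingType)
  (R_countable : countable_zero_base R) (S_countable : countable_zero_base S)
  (f : continuousRMorphism R S) (f_proflat : left_proflat f) :
  exists (gamma : forall P : contramodule R, contra_structure S (coext f P))
         (gammaF : coext_functorial gamma),
    (forall P : contramodule R, linear (@coext_contra_id R S f gamma P)) /\
    exists a : adjunction (restrict_functor f) (coext_functor gammaF),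
      forall (P : contramodule R) (h : coext f P),
        (counit a P : contra_hom (restrict f (coext_contra gamma P)) P) h =
        coext_eval h.
Proof.
have universal := proflat_free_universal R_countable f_proflat.
exists (coext_structure universal), (@coext_structure_functorial _ _ _ universal).
split; [exact: coext_structure_linear|exact: coext_adjunction].
Qed.
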